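(* Let $\mathcal{C}$ and $\mathcal{D}$ be pivotal categories and let $U:\mathcal{D}\to\mathcal{C}$ be a pivotal functor (a strong monoidal functor preserving the pivotal structures) which strictly preserves duality morphisms, i.e. the induced isomorphisms $\zeta:U({}^{\vee}-)\to{}^{\vee}U(-)$ are identity morphisms. Then the dual $U^{\circ}$ of $U$ is a pivotal category such that the forgetful functor $U^{\circ}\to\mathcal{C}$, $(X,\sigma)\mapsto X$, preserves its pivotal structure.
   Context: Monoidal categories $(\mathcal{C},\otimes,\mathbf 1)$ are assumed strict; object names also denote identity morphisms. Duals: a left dual of $X$ is an object ${}^{\vee}X$ with $\mathrm{ev}_X:{}^{\vee}X\otimes X\to\mathbf 1$, $\mathrm{coev}_X:\mathbf 1\to X\otimes{}^{\vee}X$ satisfying the triangle identities; right duals are defined symmetrically. A category is rigid if all objects have left and right duals; duals are chosen. For $f:X\to Y$, ${}^{\vee}f=(\mathrm{ev}_Y\otimes{}^{\vee}X)({}^{\vee}Y\otimes f\otimes{}^{\vee}X)({}^{\vee}Y\otimes\mathrm{coev}_X)$. A pivotal category is a rigid monoidal category with a monoidal natural isomorphism $\varrho:\mathrm{id}\to{}^{\vee\vee}(-)$, called its pivotal structure. For a strong monoidal functor $F$ between rigid categories, with structure isomorphisms $F_2(X,Y):F(X)\otimes F(Y)\to F(X\otimes Y)$, $F_0:\mathbf 1\to F(\mathbf 1)$, the induced isomorphism is $\zeta_X=(F_0^{-1}F(\mathrm{ev}_X)F_2({}^{\vee}X,X)\otimes{}^{\vee}F(X))(F({}^{\vee}X)\otimes\mathrm{coev}_{F(X)}):F({}^{\vee}X)\to{}^{\vee}F(X)$.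 If source and target have pivotal structures $\varrho,\varrho'$, then $F$ preserves the pivotal structure (is a pivotal functor) if $\varrho'_{F(X)}={}^{\vee}(\zeta_X^{-1})\,\zeta_{{}^{\vee}X}\,F(\varrho_X)$ for all $X$. The dual $U^{\circ}$ of a strong monoidal functor $U:\mathcal{D}\to\mathcal{C}$: objects are pairs $(X,\sigma)$ with $X$ an object of $\mathcal{C}$ and $\sigma:X\otimes U\Rightarrow U\otimes X$ a natural monoidal isomorphism, i.e. a natural isomorphism $\sigma_A:X\otimes U(A)\to U(A)\otimes X$ with $\sigma_{A\otimes B}(X\otimes U_2(A,B))=(U_2(A,B)\otimes X)(U(A)\otimes\sigma_B)(\sigma_A\otimes U(B))$ and $\sigma_{\mathbf 1}(X\otimes U_0)=U_0\otimes X$. Morphisms $(X,\sigma)\to(Y,\tau)$ are morphisms $f:X\to Y$ in $\mathcal{C}$ with $\tau_A(f\otimes U(A))=(U(A)\otimes f)\sigma_A$ for all $A$. It is monoidal via $(X,\sigma)\otimes(Y,\tau)=(X\otimes Y,(\sigma\otimes Y)(X\otimes\tau))$, with the forgetful functor to $\mathcal{C}$ strict monoidal. *)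

(* Defs.v *)
From mathcomp Require Import ssreflect ssrfun.
From Stdlib Require Import ProofIrrelevance FunctionalExtensionality.

Set Implicit Arguments.
Unset Strict Implicit.
Unset Printing Implicit Defensive.

Declare Scope cat_scope.
Delimit Scope cat_scope with cat.
Local Open Scope cat_scope.

Record category := Category {
  ob :> Type;
  hom : ob -> ob -> Type;
  idm : forall X, hom X X;
  comp : forall X Y Z, hom Y Z -> hom X Y -> hom X Z;
  compA : forall W X Y Z (h : hom Y Z) (g : hom X Y) (f : hom W X),
    comp h (comp g f) = comp (comp h g) f;
  comp1m : forall X Y (f : hom X Y), comp (idm Y) f = f;
  compm1 : forall X Y (f : hom X Y), comp f (idm X) = f
}.

Arguments hom {c} X Y.
Arguments idm {c} X.
Arguments comp {c X Y Z} g f.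

Notation "g \o f" := (comp g f) : cat_scope.

Section CategoryDefs.
Variable C : category.
Implicit Types X Y Z : C.

Definition inverse_of X Y (f : hom X Y) (g : hom Y X) : Prop :=
  g \o f = idm X /\ f \o g = idm Y.

Definition is_iso X Y (f : hom X Y) : Prop := exists g, inverse_of f g.

(* The identity morphism between propositionally equal objects.  In a strict
   monoidal category this mediates between (X (x) Y) (x) Z and
   X (x) (Y (x) Z), which are equal but not convertible. *)
Definition eqhom X Y (e : X = Y) : hom X Y :=
  match e in _ = Z return hom X Z with erefl => idm X end.

End CategoryDefs.

Record strict_monoidal := StrictMonoidal {
  mcat :> category;
  tens : mcat -> mcat -> mcat;
  munit : mcat;
  tensm : forall X X' Y Y' : mcat,
    hom X X' -> hom Y Y' -> hom (tens X Y) (tens X' Y');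
  tensm_id : forall X Y, tensm (idm X) (idm Y) = idm (tens X Y);
  tensm_comp : forall (X X' X'' Y Y' Y'' : mcat) (f' : hom X' X'')
      (f : hom X X') (g' : hom Y' Y'') (g : hom Y Y'),
    tensm (f' \o f) (g' \o g) = tensm f' g' \o tensm f g;
  tensA : forall X Y Z, tens (tens X Y) Z = tens X (tens Y Z);
  tens1o : forall X, tens munit X = X;
  tenso1 : forall X, tens X munit = X;
  tensmA : forall (X X' Y Y' Z Z' : mcat)
      (f : hom X X') (g : hom Y Y') (h : hom Z Z'),
    eqhom (tensA X' Y' Z') \o tensm (tensm f g) h =
    tensm f (tensm g h) \o eqhom (tensA X Y Z);
  tensm1m : forall (X X' : mcat) (f : hom X X'),
    eqhom (tens1o X') \o tensm (idm munit) f = f \o eqhom (tens1o X);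
  tensmm1 : forall (X X' : mcat) (f : hom X X'),
    eqhom (tenso1 X') \o tensm f (idm munit) = f \o eqhom (tenso1 X)
}.

Arguments tens {s} X Y.
Arguments munit {s}.
Arguments tensm {s X X' Y Y'} f g.

Notation "X \ox Y" := (tens X Y)
  (at level 40, left associativity) : cat_scope.
Notation "f \xm g" := (tensm f g)
  (at level 40, left associativity) : cat_scope.
Notation "\1" := munit (at level 0) : cat_scope.

Section MonoidalDefs.
Variable C : strict_monoidal.
Implicit Types X Y Z L : C.

(* All identity morphisms, up to the strictness equations on objects. *)
Definition assoc X Y Z : hom ((X \ox Y) \ox Z) (X \ox (Y \ox Z)) :=
  eqhom (tensA X Y Z).
Definition associ X Y Z : hom (X \ox (Y \ox Z)) ((X \ox Y) \ox Z) :=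
  eqhom (esym (tensA X Y Z)).
Definition lun X : hom (\1 \ox X) X := eqhom (tens1o X).
Definition luni X : hom X (\1 \ox X) := eqhom (esym (tens1o X)).
Definition run X : hom (X \ox \1) X := eqhom (tenso1 X).
Definition runi X : hom X (X \ox \1) := eqhom (esym (tenso1 X)).

Record left_dual X := LeftDual {
  ldob : C;
  ldev : hom (ldob \ox X) \1;
  ldcoev : hom \1 (X \ox ldob);
  ld_triangle : run X \o (idm X \xm ldev) \o assoc X ldob X
                  \o (ldcoev \xm idm X) \o luni X = idm X;
  ld_triangle' : lun ldob \o (ldev \xm idm ldob) \o associ ldob X ldob
                  \o (idm ldob \xm ldcoev) \o runi ldob = idm ldob
}.

Record right_dual X := RightDual {
  rdob : C;
  rdev : hom (X \ox rdob) \1;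
  rdcoev : hom \1 (rdob \ox X);
  rd_triangle : lun X \o (rdev \xm idm X) \o associ X rdob X
                  \o (idm X \xm rdcoev) \o runi X = idm X;
  rd_triangle' : run rdob \o (idm rdob \xm rdev) \o assoc rdob X rdob
                  \o (rdcoev \xm idm rdob) \o luni rdob = idm rdob
}.

Record rigid_structure := RigidStructure {
  ldual_of : forall X, left_dual X;
  rdual_of : forall X, right_dual X
}.

(* (e (x) L') (L (x) c) for a pairing e and a copairing c. *)
Definition mate X L L' (e : hom (L \ox X) \1) (c : hom \1 (X \ox L')) :
    hom L L' :=
  lun L' \o (e \xm idm L') \o associ L X L' \o (idm L \xm c) \o runi L.

End MonoidalDefs.

Section RigidDefs.
Variables (C : strict_monoidal) (R : rigid_structure C).
Implicit Types X Y : C.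

Definition ldual X : C := ldob (ldual_of R X).
Definition ev X : hom (ldual X \ox X) \1 := ldev (ldual_of R X).
Definition coev X : hom \1 (X \ox ldual X) := ldcoev (ldual_of R X).

Definition ldualm X Y (f : hom X Y) : hom (ldual Y) (ldual X) :=
  lun (ldual X) \o (ev Y \xm idm (ldual X)) \o associ (ldual Y) Y (ldual X)
    \o (idm (ldual Y) \xm (f \xm idm (ldual X)))
    \o (idm (ldual Y) \xm coev X) \o runi (ldual Y).

(* The pairing and copairing exhibiting the tensor product of the duals of Y
   and X (in this order) as a left dual of X (x) Y. *)
Definition ev_tens X Y :
    hom ((ldual Y \ox ldual X) \ox (X \ox Y)) \1 :=
  ev Y
    \o (idm (ldual Y) \xm
          (lun Y \o (ev X \xm idm Y) \o associ (ldual X) X Y))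
    \o assoc (ldual Y) (ldual X) (X \ox Y).
Definition coev_tens X Y :
    hom \1 ((X \ox Y) \ox (ldual Y \ox ldual X)) :=
  associ X Y (ldual Y \ox ldual X)
    \o (idm X \xm
          (assoc Y (ldual Y) (ldual X) \o (coev Y \xm idm (ldual X))
             \o luni (ldual X)))
    \o coev X.

(* The canonical isomorphisms making the left dual functor (contravariant and
   tensor-reversing) strong monoidal, and their inverses. *)
Definition ldual2 X Y : hom (ldual Y \ox ldual X) (ldual (X \ox Y)) :=
  mate (ev_tens X Y) (coev (X \ox Y)).
Definition ldual2i X Y : hom (ldual (X \ox Y)) (ldual Y \ox ldual X) :=
  mate (ev (X \ox Y)) (coev_tens X Y).
Definition ldual0 : hom \1 (ldual \1) := mate (lun \1) (coev \1).
Definition ldual0i : hom (ldual \1) \1 := mate (ev \1) (luni \1).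

(* The structure isomorphisms of the double left dual functor. *)
Definition lddual2 X Y :
    hom (ldual (ldual X) \ox ldual (ldual Y)) (ldual (ldual (X \ox Y))) :=
  ldualm (ldual2i X Y) \o ldual2 (ldual Y) (ldual X).
Definition lddual0 : hom \1 (ldual (ldual \1)) := ldualm ldual0i \o ldual0.

End RigidDefs.

Record pivotal_structure (C : strict_monoidal) := PivotalStructure {
  prigid :> rigid_structure C;
  pivot : forall X : C, hom X (ldual prigid (ldual prigid X));
  pivot_natural : forall (X Y : C) (f : hom X Y),
    pivot Y \o f = ldualm prigid (ldualm prigid f) \o pivot X;
  pivot_iso : forall X, is_iso (pivot X);
  pivot_tens : forall X Y,
    pivot (X \ox Y) = lddual2 prigid X Y \o (pivot X \xm pivot Y);
  pivot_unit : pivot \1 = lddual0 prigid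
}.

Record pivotal_category := PivotalCategory {
  pmon :> strict_monoidal;
  pstr : pivotal_structure pmon
}.

Record strong_monoidal_functor (D C : strict_monoidal) :=
    StrongMonoidalFunctor {
  fob :> D -> C;
  fmap : forall A B : D, hom A B -> hom (fob A) (fob B);
  fmap_id : forall A, fmap (idm A) = idm (fob A);
  fmap_comp : forall (A B E : D) (g : hom B E) (f : hom A B),
    fmap (g \o f) = fmap g \o fmap f;
  fun2 : forall A B, hom (fob A \ox fob B) (fob (A \ox B));
  fun2i : forall A B, hom (fob (A \ox B)) (fob A \ox fob B);
  fun0 : hom \1 (fob \1);
  fun0i : hom (fob \1) \1;
  fun2K : forall A B, inverse_of (fun2 A B) (fun2i A B);
  fun0K : inverse_of fun0 fun0i;
  fun2_natural : forall (A A' B B' : D) (f : hom A A') (g : hom B B'),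
    fun2 A' B' \o (fmap f \xm fmap g) = fmap (f \xm g) \o fun2 A B;
  fun2_assoc : forall A B E,
    fmap (assoc A B E) \o fun2 (A \ox B) E \o (fun2 A B \xm idm (fob E)) =
    fun2 A (B \ox E) \o (idm (fob A) \xm fun2 B E)
      \o assoc (fob A) (fob B) (fob E);
  fun2_unitl : forall A,
    fmap (lun A) \o fun2 \1 A \o (fun0 \xm idm (fob A)) = lun (fob A);
  fun2_unitr : forall A,
    fmap (run A) \o fun2 A \1 \o (idm (fob A) \xm fun0) = run (fob A)
}.

Arguments fmap {D C} s {A B} f.
Arguments fun2 {D C} s A B.
Arguments fun2i {D C} s A B.
Arguments fun0 {D C} s.
Arguments fun0i {D C} s.

Section FunctorDuals.
Variables (D C : strict_monoidal) (F : strong_monoidal_functor D C).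

Definition zeta (RD : rigid_structure D) (RC : rigid_structure C) (A : D) :
    hom (F (ldual RD A)) (ldual RC (F A)) :=
  mate (fun0i F \o fmap F (ev RD A) \o fun2 F (ldual RD A) A) (coev RC (F A)).

Definition strictly_preserves_duality
    (RD : rigid_structure D) (RC : rigid_structure C) : Prop :=
  forall A : D, exists e : F (ldual RD A) = ldual RC (F A),
    zeta RD RC A = eqhom e.

(* zeta is always invertible; z is its inverse. *)
Definition preserves_pivotal
    (PD : pivotal_structure D) (PC : pivotal_structure C) : Prop :=
  forall A : D,
    exists z : hom (ldual PC (F A)) (F (ldual PD A)),
      inverse_of (zeta PD PC A) z /\
      pivot PC (F A) =
        ldualm PC z \o zeta PD PC (ldual PD A) \o fmap F (pivot PD A).

End FunctorDuals.

Section EqHom.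
Variable C : category.
Implicit Types X Y Z : C.

Lemma eqhom_irr X Y (e e' : X = Y) : eqhom e = eqhom e'.
Proof. by rewrite (proof_irrelevance _ e e'). Qed.

Lemma eqhom_id X (e : X = X) : eqhom e = idm X.
Proof. exact: (eqhom_irr e erefl). Qed.

Lemma eqhom_comp X Y Z (e' : Y = Z) (e : X = Y) :
  eqhom e' \o eqhom e = eqhom (etrans e e').
Proof. by case: Z / e'; rewrite /= comp1m. Qed.

Lemma eqhom_compK X Y Z W (e' : Y = Z) (e : X = Y) (f : hom W X) :
  eqhom e' \o (eqhom e \o f) = eqhom (etrans e e') \o f.
Proof. by rewrite compA eqhom_comp. Qed.

Lemma iso_eqhom X Y (e : X = Y) : is_iso (eqhom e).
Proof. by exists (eqhom (esym e)); split; rewrite eqhom_comp eqhom_id. Qed.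

Lemma iso_comp X Y Z (g : hom Y Z) (f : hom X Y) :
  is_iso g -> is_iso f -> is_iso (g \o f).
Proof.
move=> [g' [g1 g2]] [f' [f1 f2]]; exists (f' \o g'); split.
- by rewrite -compA (compA g') g1 comp1m f1.
- by rewrite -compA (compA f) f2 comp1m g2.
Qed.

End EqHom.

Section MonoidalLemmas.
Variable C : strict_monoidal.
Implicit Types X Y Z : C.

Lemma eqhom_tens X X' Y Y' (e : X = X') (e' : Y = Y') :
  eqhom e \xm eqhom e' = eqhom (f_equal2 (@tens C) e e').
Proof. by case: X' / e; case: Y' / e'; rewrite !eqhom_id tensm_id. Qed.

Lemma eqhom_tensl X X' Y (e : X = X') :
  eqhom e \xm idm Y = eqhom (f_equal (fun W => W \ox Y) e).
Proof. by case: X' / e; rewrite /= tensm_id. Qed.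

Lemma eqhom_tensr X Y Y' (e : Y = Y') :
  idm X \xm eqhom e = eqhom (f_equal (fun W => X \ox W) e).
Proof. by case: Y' / e; rewrite /= tensm_id. Qed.

Lemma iso_tens X X' Y Y' (f : hom X X') (g : hom Y Y') :
  is_iso f -> is_iso g -> is_iso (f \xm g).
Proof.
move=> [f' [f1 f2]] [g' [g1 g2]]; exists (f' \xm g'); split.
- by rewrite -tensm_comp f1 g1 tensm_id.
- by rewrite -tensm_comp f2 g2 tensm_id.
Qed.

Lemma tens_compl X Y Z W (g : hom Y Z) (f : hom X Y) :
  (g \o f) \xm idm W = (g \xm idm W) \o (f \xm idm W).
Proof. by rewrite -tensm_comp comp1m. Qed.

Lemma tens_compr X Y Z W (g : hom Y Z) (f : hom X Y) :
  idm W \xm (g \o f) = (idm W \xm g) \o (idm W \xm f).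
Proof. by rewrite -tensm_comp comp1m. Qed.

Lemma tensmAE X X' Y Y' Z Z'
    (f : hom X X') (g : hom Y Y') (h : hom Z Z') :
  (f \xm g) \xm h =
  associ X' Y' Z' \o ((f \xm (g \xm h)) \o assoc X Y Z).
Proof. by rewrite /assoc -tensmA compA eqhom_comp eqhom_id comp1m. Qed.

Lemma tensm_idA X Y Z Z' (h : hom Z Z') :
  idm X \xm (idm Y \xm h) =
  assoc X Y Z' \o ((idm (X \ox Y) \xm h) \o associ X Y Z).
Proof.
rewrite -tensm_id compA [assoc _ _ _ \o _]tensmA -compA.
by rewrite eqhom_comp eqhom_id compm1.
Qed.

Lemma tensm_xchg X X' Y Y' (f : hom X X') (g : hom Y Y') :
  (f \xm idm Y') \o (idm X \xm g) = (idm X' \xm g) \o (f \xm idm Y).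
Proof. by rewrite -!tensm_comp !comp1m !compm1. Qed.

End MonoidalLemmas.

Section Dual.
Variables (D C : strict_monoidal) (U : strong_monoidal_functor D C).

Record half_braiding (X : C)
    (s : forall A : D, hom (X \ox U A) (U A \ox X)) : Prop := HalfBraiding {
  hb_natural : forall (A B : D) (f : hom A B),
    s B \o (idm X \xm fmap U f) = (fmap U f \xm idm X) \o s A;
  hb_iso : forall A, is_iso (s A);
  hb_tens : forall A B,
    s (A \ox B) \o (idm X \xm fun2 U A B) =
    (fun2 U A B \xm idm X)
      \o associ (U A) (U B) X \o (idm (U A) \xm s B) \o assoc (U A) X (U B)
      \o (s A \xm idm (U B)) \o associ X (U A) (U B);
  hb_unit :
    s \1 \o (idm X \xm fun0 U) \o runi X = (fun0 U \xm idm X) \o luni X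
}.

Record dual_ob := DualOb {
  dob : C;
  dhb : forall A : D, hom (dob \ox U A) (U A \ox dob);
  dhbP : half_braiding dhb
}.

Record dual_hom (S T : dual_ob) := DualHom {
  dmap : hom (dob S) (dob T);
  dmapP : forall A : D,
    dhb T A \o (dmap \xm idm (U A)) = (idm (U A) \xm dmap) \o dhb S A
}.

Lemma dual_hom_eq S T (f g : dual_hom S T) : dmap f = dmap g -> f = g.
Proof.
case: f g => [f Pf] [g Pg] /= E; case: g / E Pg => Pg.
by rewrite (proof_irrelevance _ Pf Pg).
Qed.

Lemma dual_ob_eq S T (e : dob S = dob T) :
  (forall A, dhb T A \o (eqhom e \xm idm (U A)) =
             (idm (U A) \xm eqhom e) \o dhb S A) -> S = T.
Proof.
case: S T e => [X s Ps] [Y t Pt] /= e; case: Y / e t Pt => t Pt /= E.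
have Est : s = t.
  apply: functional_extensionality_dep => A.
  by have := E A; rewrite !tensm_id compm1 comp1m.
by case: t / Est Pt {E} => Pt; rewrite (proof_irrelevance _ Ps Pt).
Qed.

Lemma dual_id_subproof (S : dual_ob) A :
  dhb S A \o (idm (dob S) \xm idm (U A)) =
  (idm (U A) \xm idm (dob S)) \o dhb S A.
Proof. by rewrite !tensm_id compm1 comp1m. Qed.

Definition dual_id (S : dual_ob) : dual_hom S S :=
  DualHom (@dual_id_subproof S).

Lemma dual_comp_subproof S T V (g : dual_hom T V) (f : dual_hom S T) A :
  dhb V A \o ((dmap g \o dmap f) \xm idm (U A)) =
  (idm (U A) \xm (dmap g \o dmap f)) \o dhb S A.
Proof. by rewrite tens_compl compA dmapP -compA dmapP compA -tens_compr. Qed.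

Definition dual_comp S T V (g : dual_hom T V) (f : dual_hom S T) :
    dual_hom S V :=
  DualHom (dual_comp_subproof g f).

Definition dual_category : category.
Proof.
refine (@Category dual_ob dual_hom dual_id dual_comp _ _ _).
- abstract (by move=> W X Y Z h g f; apply: dual_hom_eq; rewrite /= compA).
- abstract (by move=> X Y f; apply: dual_hom_eq; rewrite /= comp1m).
- abstract (by move=> X Y f; apply: dual_hom_eq; rewrite /= compm1).
Defined.

Lemma dmap_eqhom (S T : dual_category) (e : S = T) (e' : dob S = dob T) :
  dmap (eqhom e) = eqhom e'.
Proof. by case: T / e e' => e'; rewrite !eqhom_id. Qed.

Definition tens_hb (S T : dual_ob) (A : D) :
    hom ((dob S \ox dob T) \ox U A) (U A \ox (dob S \ox dob T)) :=
  assoc (U A) (dob S) (dob T) \o (dhb S A \xm idm (dob T))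
    \o associ (dob S) (U A) (dob T) \o (idm (dob S) \xm dhb T A)
    \o assoc (dob S) (dob T) (U A).

Definition unit_hb (A : D) : hom (\1 \ox U A) (U A \ox \1) :=
  runi (U A) \o lun (U A).


Lemma tens_hb_natural (S T : dual_ob) (A B : D) (f : hom A B) :
  tens_hb S T B \o (idm _ \xm fmap U f) =
  (fmap U f \xm idm _) \o tens_hb S T A.
Proof.
rewrite /tens_hb -(tensm_id (dob S)) -!compA.
have -> : assoc (dob S) (dob T) (U B) \o
    ((idm (dob S) \xm idm (dob T)) \xm fmap U f) =
    (idm (dob S) \xm (idm (dob T) \xm fmap U f)) \o assoc _ _ _.
  exact: tensmA.
rewrite (compA (idm (dob S) \xm dhb T B)) -tens_compr.
rewrite (hb_natural (dhbP T)) tens_compr -compA.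
rewrite (compA (associ _ _ _)).
have -> : associ (dob S) (U B) (dob T) \o
    (idm (dob S) \xm (fmap U f \xm idm (dob T))) =
    ((idm (dob S) \xm fmap U f) \xm idm (dob T)) \o associ _ _ _.
  by rewrite tensmAE -!compA eqhom_comp eqhom_id compm1.
rewrite -(compA _ (associ _ _ _)) (compA (dhb S B \xm _)) -tens_compl.
rewrite (hb_natural (dhbP S)) tens_compl -!compA.
rewrite (compA (assoc _ _ _)) [assoc _ _ _ \o _]tensmA.
by rewrite tensm_id -!compA.
Qed.

Lemma tens_hb_iso (S T : dual_ob) A : is_iso (tens_hb S T A).
Proof.
have idI (X : C) : is_iso (idm X) by exact: (iso_eqhom erefl).
rewrite /tens_hb; do !apply: iso_comp; try exact: iso_eqhom.
- by apply: iso_tens => //; apply: hb_iso (dhbP S) A.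
- by apply: iso_tens => //; apply: hb_iso (dhbP T) A.
Qed.

Lemma tens_hb_tens (S T : dual_ob) A B :
    tens_hb S T (A \ox B) \o (idm _ \xm fun2 U A B) =
    (fun2 U A B \xm idm _)
      \o associ (U A) (U B) _ \o (idm (U A) \xm tens_hb S T B) \o assoc (U A) _ (U B)
      \o (tens_hb S T A \xm idm (U B)) \o associ _ (U A) (U B).
Proof.
rewrite {1}/tens_hb -(tensm_id (dob S)) -!compA.
have -> : assoc (dob S) (dob T) (U (A \ox B)) \o
    ((idm (dob S) \xm idm (dob T)) \xm fun2 U A B) =
    (idm (dob S) \xm (idm (dob T) \xm fun2 U A B)) \o assoc _ _ _.
  exact: tensmA.
rewrite (compA (idm (dob S) \xm dhb T _)) -tens_compr (hb_tens (dhbP T)).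
rewrite -!compA tens_compr -!compA.
rewrite (compA (associ _ _ _)).
have -> : associ (dob S) (U (A \ox B)) (dob T) \o
    (idm (dob S) \xm (fun2 U A B \xm idm (dob T))) =
    ((idm (dob S) \xm fun2 U A B) \xm idm (dob T)) \o associ _ _ _.
  by rewrite tensmAE -!compA eqhom_comp eqhom_id compm1.
rewrite -!compA (compA (dhb S _ \xm _)) -tens_compl (hb_tens (dhbP S)).
rewrite -!compA tens_compl -!compA.
rewrite (compA (assoc _ _ _)) [assoc _ _ _ \o _]tensmA tensm_id -!compA.
congr (_ \o _).
rewrite /tens_hb !tens_compl !tens_compr -?compA.
rewrite /assoc /associ !(eqhom_tensl, eqhom_tensr).
rewrite !tensmAE ?(tens_compr, tens_compl) /assoc /associ.
rewrite ?(eqhom_tensl, eqhom_tensr) -?compA.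
rewrite !(eqhom_compK, eqhom_comp).
rewrite !tensm_id !tensm_idA -!compA /assoc /associ !eqhom_compK.
rewrite !eqhom_id !comp1m.
rewrite (compA (dhb S A \xm _)) tensm_xchg -!compA.
rewrite /assoc /associ ?eqhom_compK.
by do ?[exact: eqhom_irr | congr (_ \o _)].
Qed.

Lemma tens_hb_unit (S T : dual_ob) :
  tens_hb S T \1 \o (idm _ \xm fun0 U) \o runi _ =
  (fun0 U \xm idm _) \o luni _.
Proof.
rewrite {1}/tens_hb -(tensm_id (dob S)) tensmAE -!compA.
rewrite (compA (assoc _ _ _) (associ _ _ _)) eqhom_comp eqhom_id comp1m.
rewrite (compA (idm (dob S) \xm dhb T _)) -tens_compr.
have E (V : dual_ob) : dhb V \1 \o (idm (dob V) \xm fun0 U) =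
    ((fun0 U \xm idm _) \o luni _) \o run _.
  rewrite -(hb_unit (dhbP V)) -!compA [runi _ \o _]eqhom_comp eqhom_id.
  by rewrite compm1.
rewrite E !tens_compr -!compA (compA (associ _ _ _)).
have -> : associ (dob S) (U \1) (dob T) \o
    (idm (dob S) \xm (fun0 U \xm idm (dob T))) =
    ((idm (dob S) \xm fun0 U) \xm idm (dob T)) \o associ _ _ _.
  by rewrite tensmAE -!compA eqhom_comp eqhom_id compm1.
rewrite -!compA (compA (dhb S _ \xm _)) -tens_compl E !tens_compl -!compA.
rewrite tensmAE tensm_id -!compA.
rewrite (compA (assoc _ _ _)) eqhom_comp eqhom_id comp1m.
congr (_ \o _).
rewrite /assoc /associ /run /runi /luni !(eqhom_tensl, eqhom_tensr).
by rewrite !eqhom_comp; apply: eqhom_irr.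
Qed.

Lemma tens_hbP (S T : dual_ob) : half_braiding (tens_hb S T).
Proof.
split.
- exact: tens_hb_natural.
- exact: tens_hb_iso.
- exact: tens_hb_tens.
- exact: tens_hb_unit.
Qed.

Lemma unit_hbP : half_braiding unit_hb.
Proof.
split=> [A B f|A|A B|]; rewrite /unit_hb.
- rewrite -compA tensm1m compA.
  have -> : runi (U B) \o fmap U f = (fmap U f \xm idm \1) \o runi (U A).
    have := congr1 (fun h => runi (U B) \o h \o runi (U A)) (tensmm1 (fmap U f)).
    rewrite -!compA eqhom_comp eqhom_id compm1 => <-.
    by rewrite (compA (runi _)) eqhom_comp eqhom_id comp1m.
  by rewrite -compA.
- by rewrite eqhom_comp; apply: iso_eqhom.
- rewrite -compA tensm1m compA.
  have -> : runi _ \o fun2 U A B = (fun2 U A B \xm idm \1) \o runi _.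
    have := congr1 (fun h => runi _ \o h \o runi _) (tensmm1 (fun2 U A B)).
    rewrite -!compA eqhom_comp eqhom_id compm1 => <-.
    by rewrite (compA (runi _)) eqhom_comp eqhom_id comp1m.
  rewrite -!compA; congr (_ \o _).
  rewrite /assoc /associ /runi /lun !eqhom_comp !(eqhom_tensl, eqhom_tensr).
  by rewrite !eqhom_comp; apply: eqhom_irr.
- rewrite -!compA (compA (lun _)) tensm1m -!compA compA.
  have -> : runi _ \o fun0 U = (fun0 U \xm idm \1) \o runi _.
    have := congr1 (fun h => runi _ \o h \o runi _) (tensmm1 (fun0 U)).
    rewrite -!compA eqhom_comp eqhom_id compm1 => <-.
    by rewrite (compA (runi _)) eqhom_comp eqhom_id comp1m.
  by rewrite -compA; congr (_ \o _); rewrite !eqhom_comp; apply: eqhom_irr.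
Qed.

Definition dual_tens (S T : dual_ob) : dual_ob := DualOb (tens_hbP S T).
Definition dual_unit : dual_ob := DualOb unit_hbP.

Lemma dual_tensm_subproof S S' T T' (f : dual_hom S S') (g : dual_hom T T') A :
  tens_hb S' T' A \o ((dmap f \xm dmap g) \xm idm (U A)) =
  (idm (U A) \xm (dmap f \xm dmap g)) \o tens_hb S T A.
Proof.
rewrite /tens_hb -!compA.
have -> : assoc (dob S') (dob T') (U A) \o
    ((dmap f \xm dmap g) \xm idm (U A)) =
    (dmap f \xm (dmap g \xm idm (U A))) \o assoc _ _ _ by exact: tensmA.
rewrite (compA (idm (dob S') \xm _)) -tensm_comp dmapP comp1m.
rewrite -[dmap f in LHS]compm1 tensm_comp -compA (compA (associ _ _ _)).
have -> : associ (dob S') (U A) (dob T') \o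
    (dmap f \xm (idm (U A) \xm dmap g)) =
    ((dmap f \xm idm (U A)) \xm dmap g) \o associ _ _ _.
  by rewrite tensmAE -!compA eqhom_comp eqhom_id compm1.
rewrite -compA (compA (dhb S' A \xm _)) -tensm_comp dmapP comp1m.
rewrite -[dmap g in LHS]compm1 tensm_comp -!compA (compA (assoc _ _ _)).
by rewrite [assoc _ _ _ \o _]tensmA -!compA.
Qed.

Definition dual_tensm S S' T T' (f : dual_hom S S') (g : dual_hom T T') :
    dual_hom (dual_tens S T) (dual_tens S' T') :=
  @DualHom (dual_tens S T) (dual_tens S' T') _ (dual_tensm_subproof f g).

Lemma dual_tensA S T V :
  dual_tens (dual_tens S T) V = dual_tens S (dual_tens T V).
Proof.
apply: (@dual_ob_eq (dual_tens (dual_tens S T) V)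
  (dual_tens S (dual_tens T V)) (tensA (dob S) (dob T) (dob V))) => A /=.
rewrite /tens_hb /=.
rewrite /tens_hb !tens_compl !tens_compr -?compA -(tensm_id (dob S)).
rewrite /assoc /associ !(eqhom_tensl, eqhom_tensr).
rewrite !tensmAE ?tensm_idA /assoc /associ.
rewrite ?(eqhom_tensl, eqhom_tensr) -?compA !(eqhom_compK, eqhom_comp).
rewrite !tensm_id.
by do ?[exact: eqhom_irr | congr (_ \o _)].
Qed.

Lemma dual_tens1o S : dual_tens dual_unit S = S.
Proof.
apply: (@dual_ob_eq (dual_tens dual_unit S) S (tens1o (dob S))) => A /=.
rewrite /tens_hb /= /unit_hb.
have -> : idm \1 \xm dhb S A = luni _ \o (dhb S A \o lun _).
  by rewrite -tensm1m compA eqhom_comp eqhom_id comp1m.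
rewrite /assoc /associ /lun /luni /runi eqhom_comp !(eqhom_tensl, eqhom_tensr).
rewrite -!compA !(eqhom_compK, eqhom_comp) eqhom_id comp1m.
by do ?[exact: eqhom_irr | congr (_ \o _)].
Qed.

Lemma dual_tenso1 S : dual_tens S dual_unit = S.
Proof.
apply: (@dual_ob_eq (dual_tens S dual_unit) S (tenso1 (dob S))) => A /=.
rewrite /tens_hb /= /unit_hb.
have -> : dhb S A \xm idm \1 = runi _ \o (dhb S A \o run _).
  by rewrite -tensmm1 compA eqhom_comp eqhom_id comp1m.
rewrite /assoc /associ /lun /run /runi eqhom_comp !(eqhom_tensl, eqhom_tensr).
rewrite -!compA !(eqhom_compK, eqhom_comp) eqhom_id comp1m.
by do ?[exact: eqhom_irr | congr (_ \o _)].
Qed.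

Lemma dmap_assoc (X Y Z : dual_category)
    (e : dual_tens (dual_tens X Y) Z = dual_tens X (dual_tens Y Z)) :
  dmap (eqhom (C := dual_category) e) = assoc (dob X) (dob Y) (dob Z).
Proof. exact: (dmap_eqhom e (tensA (dob X) (dob Y) (dob Z))). Qed.

Lemma dmap_lun (X : dual_category) (e : dual_tens dual_unit X = X) :
  dmap (eqhom (C := dual_category) e) = lun (dob X).
Proof. exact: (dmap_eqhom e (tens1o (dob X))). Qed.

Lemma dmap_run (X : dual_category) (e : dual_tens X dual_unit = X) :
  dmap (eqhom (C := dual_category) e) = run (dob X).
Proof. exact: (dmap_eqhom e (tenso1 (dob X))). Qed.

Definition dual_monoidal : strict_monoidal.
Proof.
refine (@StrictMonoidal dual_category dual_tens dual_unit dual_tensm _ _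
  dual_tensA dual_tens1o dual_tenso1 _ _ _).
- abstract (by move=> X Y; apply: dual_hom_eq; rewrite /= tensm_id).
- abstract (by move=> *; apply: dual_hom_eq; rewrite /= tensm_comp).
- abstract (move=> X X' Y Y' Z Z' f g h; apply: dual_hom_eq => /=;
    by rewrite !dmap_assoc; apply: tensmA).
- abstract (move=> X X' f; apply: dual_hom_eq => /=;
    by rewrite !dmap_lun; apply: tensm1m).
- abstract (move=> X X' f; apply: dual_hom_eq => /=;
    by rewrite !dmap_run; apply: tensmm1).
Defined.

Definition dual_forget : strong_monoidal_functor dual_monoidal C.
Proof.
refine (@StrongMonoidalFunctor dual_monoidal C dob dmap _ _
  (fun S T => idm (dob S \ox dob T)) (fun S T => idm (dob S \ox dob T))
  (idm \1) (idm \1) _ _ _ _ _ _) => //.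
- abstract (by move=> A B; split; rewrite comp1m).
- abstract (by split; rewrite comp1m).
- abstract (by move=> A A' B B' f g; rewrite comp1m compm1).
- abstract (move=> A B E; rewrite dmap_assoc !tensm_id;
    by rewrite !comp1m !compm1).
- abstract (by move=> A; rewrite dmap_lun !tensm_id !compm1).
- abstract (by move=> A; rewrite dmap_run !tensm_id !compm1).
Defined.

End Dual.

(* Main.v *)
From mathcomp Require Import ssreflect ssrfun.
From Stdlib Require Import IndefiniteDescription.
Require Import Defs.

(** Let (X, s) be an object of the dual of U, let L be the left dual of X in C,
    with evaluation ev and coevaluation coev.

    The left dual of (X, s) is L with the half-braiding t obtained by rotating
    the inverse of s through L: t_A = (ev U(A) L)(L s_A^-1 L)(L U(A) coev)
    (rotate, ldual_hb).  By the zigzag identities t is natural and compatible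
    with tensor products, and ev and coev are morphisms of the dual of U.  That
    t_A is invertible is where duals in D come in: a family with all properties
    of a half-braiding except invertibility is inverted by bending its component
    at a right dual of A around the images of the duality morphisms of A
    (lax_inverseP).  The same formula supplies s_A^-1.

    The pivotal structure is the one of C, so the point is that the pivot of X
    is a morphism from (X, s) to its double left dual.  Put
    v_X = ev_(dual of X) (pivot_X L) : X L -> 1.  After pairing with L, the claim
    says that v_X is itself a morphism of the dual of U (pivot_ev_dual_hom).
    To see this, three facts are combined.  Since the pivot is natural and
    monoidal, v is dinatural and v_(X Y) is v_Y nested inside v_X; at the
    morphism s_A this relates s_A to its full rotation
    (pivot_pairing_braid).  The full rotation of s_A is t at the left dual of A,
    by naturality of s with respect to the evaluation of A.  Finally, U being
    pivotal means that the image of v_A is v_(U A), up to zeta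
    (image_pivot_ev), and t is natural with respect to v_A.  Combining them
    gives the claim paired with the image of v_A, and this pairing is
    nondegenerate because v_A exhibits the left dual of A as a right dual.

    Once the pivot is an isomorphism of the dual of U, left duals serve as right
    duals (flip_dual), and all remaining axioms are equations between underlying
    morphisms that hold in C.

    Strictness holds only up to transport along equations between objects.  To
    compute with string diagrams all the same, a morphism f : X -> Y is replaced
    by the family of the morphisms W f : W X -> W Y for W in C, with every tensor
    product bracketed to the left.  Then W X Y is literally (W X) Y, tensoring
    on the left is a change of W, and no transport is left (lift). *)

Set Implicit Arguments.
Unset Strict Implicit.
Unset Printing Implicit Defensive.

Local Open Scope cat_scope.

(** * Families of morphisms with left-nested tensor products *)

Ltac eqhom_congr := do ?[exact: eqhom_irr | congr (_ \o _) | congr (_ \xm _)].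

Section Lifting.
Variable C : strict_monoidal.
Implicit Types W X Y Z : C.

(** A bracketing of a tensor product.  It is kept as data because the
    left-nested form of an object of C depends on the bracketing chosen. *)
Inductive shape := leaf of C | one | node of shape & shape.

Fixpoint flat (t : shape) : C :=
  match t with
  | leaf X => X
  | one => \1
  | node s u => flat s \ox flat u
  end.

Fixpoint act (t : shape) (W : C) : C :=
  match t with
  | leaf X => W \ox X
  | one => W
  | node s u => act u (act s W)
  end.

Fixpoint actm (t : shape) W W' (h : hom W W') : hom (act t W) (act t W') :=
  match t with
  | leaf X => h \xm idm X
  | one => h
  | node s u => actm u (actm s h)
  end.

Lemma act_flat t W : W \ox flat t = act t W.
Proof.
elim: t W => [X|/=|s IHs u IHu] W //=; first exact: tenso1.
by rewrite -IHu -IHs tensA.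
Qed.

(** The lock keeps unification from unfolding lift and meeting the transports
    inside it. *)
Fact lift_key : unit. Proof. exact: tt. Qed.

Definition lift s t (f : hom (flat s) (flat t)) W : hom (act s W) (act t W) :=
  locked_with lift_key
    (eqhom (act_flat t W) \o (idm W \xm f) \o eqhom (esym (act_flat s W))).
Arguments lift : clear implicits.

Lemma liftE s t f W :
  lift s t f W
  = eqhom (act_flat t W) \o (idm W \xm f) \o eqhom (esym (act_flat s W)).
Proof. by rewrite /lift unlock. Qed.

Lemma eqhomK (X Y : C) (e : X = Y) (e' : Y = X) : eqhom e' \o eqhom e = idm X.
Proof. by rewrite eqhom_comp eqhom_id. Qed.

Lemma eqhomKl (X Y Z : C) (e : X = Y) (e' : Y = X) (f : hom Z X) :
  eqhom e' \o (eqhom e \o f) = f.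
Proof. by rewrite compA eqhomK comp1m. Qed.

Lemma lift_comp s t u (g : hom (flat t) (flat u)) (f : hom (flat s) (flat t)) W :
  lift s u (g \o f) W = lift t u g W \o lift s t f W.
Proof. by rewrite !liftE tens_compr -!compA eqhomKl. Qed.

(** When the left-nested forms coincide definitionally, the transports of the
    strict structure become identities: e' can be taken to be erefl. *)
Lemma lift_eqhom s t (e : flat s = flat t) W (e' : act s W = act t W) :
  lift s t (eqhom e) W = eqhom e'.
Proof. by rewrite !liftE eqhom_tensr !eqhom_comp; apply: eqhom_irr. Qed.

Lemma lift_id s W : lift s s (idm (flat s)) W = idm (act s W).
Proof. exact: (@lift_eqhom s s erefl W erefl). Qed.

(** Whiskering factor by factor agrees with whiskering by the whole product; this
    is what makes lift natural in W and compatible with tensoring on the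
    right. *)
Lemma actmE t W W' (h : hom W W') :
  actm t h = eqhom (act_flat t W') \o (h \xm idm (flat t))
               \o eqhom (esym (act_flat t W)).
Proof.
elim: t W W' h => [X|/=|s IHs u IHu] W W' h.
- by rewrite /= !eqhom_id comp1m compm1.
- have := congr1 (fun k => k \o runi W) (tensmm1 h).
  rewrite -!compA eqhomK compm1 => E.
  rewrite (eqhom_irr (act_flat one W') (tenso1 W')).
  rewrite (eqhom_irr (esym (act_flat one W)) (esym (tenso1 W))).
  by rewrite -[LHS]E.
- rewrite /= IHs IHu !tens_compl !eqhom_tensl tensmAE tensm_id -!compA.
  rewrite /assoc /associ !eqhom_compK !eqhom_comp.
  by eqhom_congr.
Qed.

Lemma lift_nat s t (f : hom (flat s) (flat t)) W W' (h : hom W W') :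
  actm t h \o lift s t f W = lift s t f W' \o actm s h.
Proof.
rewrite !actmE !liftE -!compA !eqhomKl; congr (_ \o _).
by rewrite !(compA (_ \xm _)) tensm_xchg.
Qed.

Lemma lift_tensl s t u (f : hom (flat s) (flat t)) W :
  lift (node s u) (node t u) (f \xm idm (flat u)) W = actm u (lift s t f W).
Proof.
rewrite actmE !liftE !tens_compl !eqhom_tensl tensmAE -!compA.
rewrite /assoc /associ !eqhom_compK !eqhom_comp.
by eqhom_congr.
Qed.

Lemma lift_tensr s t u (f : hom (flat s) (flat t)) W :
  lift (node u s) (node u t) (idm (flat u) \xm f) W = lift s t f (act u W).
Proof.
rewrite !liftE /= tensm_idA -!compA /assoc /associ !eqhom_compK !eqhom_comp.
have E : (idm (W \ox flat u) \xm f) =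
  eqhom (esym (f_equal (fun V => V \ox flat t) (act_flat u W))) \o
  (idm (act u W) \xm f) \o
  eqhom (f_equal (fun V => V \ox flat s) (act_flat u W)).
  rewrite -!eqhom_tensl -compA -tensm_xchg compA.
  rewrite (eqhom_irr (esym _)
    (f_equal (fun V => V \ox flat t) (esym (act_flat u W)))).
  by rewrite -eqhom_tensl -tens_compl eqhomK tensm_id comp1m.
rewrite E -!compA !eqhom_compK !eqhom_comp.
by eqhom_congr.
Qed.

(** The member of the family at the unit already determines the morphism. *)
Lemma lift_inj s t (f g : hom (flat s) (flat t)) :
  (forall W, lift s t f W = lift s t g W) -> f = g.
Proof.
have E (k : hom (flat s) (flat t)) :
    k = eqhom (etrans (esym (act_flat t \1)) (tens1o _)) \o lift s t k \1
          \o eqhom (etrans (esym (tens1o _)) (act_flat s \1)).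
  rewrite !liftE -!compA !eqhom_compK !eqhom_comp.
  rewrite (eqhom_irr (etrans (act_flat _ _) _) (tens1o _)).
  rewrite compA [eqhom _ \o _]tensm1m.
  by rewrite -compA eqhomK compm1.
by move=> e; rewrite (E f) e -E.
Qed.

End Lifting.

Arguments one {C}.
Arguments lift {C} s t f W.

Ltac shape_of X :=
  lazymatch X with
  | @tens _ ?A ?B =>
      let a := shape_of A in let b := shape_of B in constr:(node a b)
  | @munit ?C => constr:(@one C)
  | _ => constr:(leaf X)
  end.

Ltac unfold_eqhom := unfold assoc, associ, lun, luni, run, runi.

(** Pushes lift through composition, identities, transports and whiskering.
    The bracketing of an intermediate object cannot be found by unification, so
    it is read off from its expression. *)
Ltac lift_step :=
  match goal with
  | |- context [@lift ?C ?s ?t (@comp _ ?X ?Y ?Z ?g ?f) ?W] =>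
      let m := shape_of Y in rewrite (@lift_comp C s m t g f W)
  | |- context [@lift ?C ?s ?t (@eqhom _ _ _ ?e) ?W] =>
      rewrite (@lift_eqhom C s t e W erefl)
  | |- context [@lift ?C ?s ?s (@idm _ _) ?W] =>
      rewrite (@lift_id C s W)
  | |- context [@lift ?C (node ?s ?u) (node ?t _)
                  (@tensm _ _ _ _ _ ?f (@idm _ _)) ?W] =>
      rewrite (@lift_tensl C s t u f W)
  | |- context [@lift ?C (node ?u ?s) (node _ ?t)
                  (@tensm _ _ _ _ _ (@idm _ _) ?f) ?W] =>
      rewrite (@lift_tensr C s t u f W)
  end; cbn [act actm eqhom].

(** Whiskering on the right by X. *)
Notation "h |> X" := (tensm h (idm X)) (at level 40, left associativity) : cat_scope.

Section Families.
Variable C : strict_monoidal.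
Implicit Types W X Y Z T L : C.

(** In the names, the two digits are the number of tensor factors of the source
    and of the target.  Each type is written out so that the families compose
    without computing act. *)
Definition at11 X Y (f : hom X Y) W : hom (W \ox X) (W \ox Y) :=
  lift (leaf X) (leaf Y) f W.
Definition at10 X (f : hom X \1) W : hom (W \ox X) W :=
  lift (leaf X) one f W.
Definition at01 X (f : hom \1 X) W : hom W (W \ox X) :=
  lift one (leaf X) f W.
Definition at20 X Y (f : hom (X \ox Y) \1) W : hom (W \ox X \ox Y) W :=
  lift (node (leaf X) (leaf Y)) one f W.
Definition at02 X Y (f : hom \1 (X \ox Y)) W : hom W (W \ox X \ox Y) :=
  lift one (node (leaf X) (leaf Y)) f W.
Definition at21 X Y Z (f : hom (X \ox Y) Z) W : hom (W \ox X \ox Y) (W \ox Z) :=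
  lift (node (leaf X) (leaf Y)) (leaf Z) f W.
Definition at12 X Y Z (f : hom Z (X \ox Y)) W : hom (W \ox Z) (W \ox X \ox Y) :=
  lift (leaf Z) (node (leaf X) (leaf Y)) f W.
Definition at22 X Y Z T (f : hom (X \ox Y) (Z \ox T)) W :
    hom (W \ox X \ox Y) (W \ox Z \ox T) :=
  lift (node (leaf X) (leaf Y)) (node (leaf Z) (leaf T)) f W.

Lemma at11E X Y (f : hom X Y) W : at11 f W = lift (leaf X) (leaf Y) f W.
Proof. by []. Qed.
Lemma at10E X (f : hom X \1) W : at10 f W = lift (leaf X) one f W.
Proof. by []. Qed.
Lemma at01E X (f : hom \1 X) W : at01 f W = lift one (leaf X) f W.
Proof. by []. Qed.
Lemma at20E X Y (f : hom (X \ox Y) \1) W :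
  at20 f W = lift (node (leaf X) (leaf Y)) one f W.
Proof. by []. Qed.
Lemma at02E X Y (f : hom \1 (X \ox Y)) W :
  at02 f W = lift one (node (leaf X) (leaf Y)) f W.
Proof. by []. Qed.
Lemma at21E X Y Z (f : hom (X \ox Y) Z) W :
  at21 f W = lift (node (leaf X) (leaf Y)) (leaf Z) f W.
Proof. by []. Qed.
Lemma at12E X Y Z (f : hom Z (X \ox Y)) W :
  at12 f W = lift (leaf Z) (node (leaf X) (leaf Y)) f W.
Proof. by []. Qed.
Lemma at22E X Y Z T (f : hom (X \ox Y) (Z \ox T)) W :
  at22 f W = lift (node (leaf X) (leaf Y)) (node (leaf Z) (leaf T)) f W.
Proof. by []. Qed.

Section Naturality.
Variables (W W' : C) (h : hom W W').

Lemma at11_nat X Y (f : hom X Y) : (h |> Y) \o at11 f W = at11 f W' \o (h |> X).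
Proof. exact: (@lift_nat C (leaf X) (leaf Y) f). Qed.
Lemma at01_nat X (f : hom \1 X) : (h |> X) \o at01 f W = at01 f W' \o h.
Proof. exact: (@lift_nat C one (leaf X) f). Qed.
Lemma at20_nat X Y (f : hom (X \ox Y) \1) :
  h \o at20 f W = at20 f W' \o (h |> X |> Y).
Proof. exact: (@lift_nat C (node (leaf X) (leaf Y)) one f). Qed.
Lemma at02_nat X Y (f : hom \1 (X \ox Y)) :
  (h |> X |> Y) \o at02 f W = at02 f W' \o h.
Proof. exact: (@lift_nat C one (node (leaf X) (leaf Y)) f). Qed.
Lemma at21_nat X Y Z (f : hom (X \ox Y) Z) :
  (h |> Z) \o at21 f W = at21 f W' \o (h |> X |> Y).
Proof. exact: (@lift_nat C (node (leaf X) (leaf Y)) (leaf Z) f). Qed.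
Lemma at22_nat X Y Z T (f : hom (X \ox Y) (Z \ox T)) :
  (h |> Z |> T) \o at22 f W = at22 f W' \o (h |> X |> Y).
Proof.
exact: (@lift_nat C (node (leaf X) (leaf Y)) (node (leaf Z) (leaf T)) f).
Qed.
End Naturality.

Lemma at11_inj X Y (f g : hom X Y) : (forall W, at11 f W = at11 g W) -> f = g.
Proof. exact: (@lift_inj C (leaf X) (leaf Y)). Qed.

Lemma at11_id X W : at11 (idm X) W = idm (W \ox X).
Proof. exact: (@lift_id C (leaf X)). Qed.

Lemma at11_comp X Y Z (g : hom Y Z) (f : hom X Y) W :
  at11 (g \o f) W = at11 g W \o at11 f W.
Proof. exact: (@lift_comp C (leaf X) (leaf Y) (leaf Z)). Qed.

End Families.

(** Rewrites an equation between morphisms of C, lifted at W, into one between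
    the families at11, ..., at22, in right-associated form. *)
Ltac lift_simpl :=
  unfold_eqhom; rewrite ?at11E ?at10E ?at01E ?at20E ?at02E ?at21E ?at12E ?at22E;
  repeat lift_step;
  rewrite -?at11E -?at10E -?at01E -?at20E -?at02E -?at21E -?at12E -?at22E
    ?comp1m ?compm1 -?compA.

Ltac lift_in E X Y W :=
  let s := shape_of X in let t := shape_of Y in
  have := congr1 (fun k => lift s t k W) E; cbn beta; lift_simpl.

Ltac by_lift :=
  match goal with |- @eq (@hom _ ?X ?Y) _ _ =>
    let s := shape_of X in let t := shape_of Y in
    let W := fresh "W" in apply: (@lift_inj _ s t) => W; lift_simpl
  end.

(** * Zigzag identities *)

Section Zigzags.
Variable C : strict_monoidal.
Implicit Types W X Y Z T L : C.

Lemma left_zigzag X (d : left_dual X) W :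
  at20 (ldev d) (W \ox X) \o (at02 (ldcoev d) W |> X) = idm (W \ox X).
Proof. by lift_in (ld_triangle d) X X W. Qed.

Lemma left_zigzag' X (d : left_dual X) W :
  (at20 (ldev d) W |> ldob d) \o at02 (ldcoev d) (W \ox ldob d)
  = idm (W \ox ldob d).
Proof. by lift_in (ld_triangle' d) (ldob d) (ldob d) W. Qed.

Lemma at11_mate X L L' (e : hom (L \ox X) \1) (c : hom \1 (X \ox L')) W :
  at11 (mate e c) W = (at20 e W |> L') \o at02 c (W \ox L).
Proof. by rewrite /mate; lift_simpl. Qed.

End Zigzags.

(** The next lemmas apply an equation in the middle of a right-associated
    composite, possibly under a whiskering. *)
Lemma comp_eq2 (C : category) (V X Y Y' Z : C) (g : hom Y Z) (f : hom X Y)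
    (g' : hom Y' Z) (f' : hom X Y') (z : hom V X) :
  g \o f = g' \o f' -> g \o (f \o z) = g' \o (f' \o z).
Proof. by move=> E; rewrite !compA E. Qed.

Lemma comp_eq1 (C : category) (V X Y Z : C) (g : hom Y Z) (f : hom X Y)
    (k : hom X Z) (z : hom V X) :
  g \o f = k -> g \o (f \o z) = k \o z.
Proof. by move=> E; rewrite compA E. Qed.

Lemma comp_eq31 (C : category) (V X Y Z T : C) (h : hom Z T) (g : hom Y Z)
    (f : hom X Y) (k : hom X T) (z : hom V X) :
  h \o (g \o f) = k -> h \o (g \o (f \o z)) = k \o z.
Proof. by move=> <-; rewrite -!compA. Qed.

Lemma whisker2 (C : strict_monoidal) (X Y Y' Z V : C) (g : hom Y Z) (f : hom X Y)
    (g' : hom Y' Z) (f' : hom X Y') :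
  g \o f = g' \o f' -> (g |> V) \o (f |> V) = (g' |> V) \o (f' |> V).
Proof. by rewrite -!tens_compl => ->. Qed.

Lemma whisker1 (C : strict_monoidal) (X Y Z V : C) (g : hom Y Z) (f : hom X Y)
    (k : hom X Z) :
  g \o f = k -> (g |> V) \o (f |> V) = k |> V.
Proof. by rewrite -tens_compl => ->. Qed.

(** * Left duals as right duals *)

Section DualOfDual.
Variables (C : strict_monoidal) (X L : C) (d : left_dual L) (r : hom X (ldob d)).

Definition flip_ev : hom (X \ox L) \1 := ldev d \o (r |> L).

Lemma at20_flip_ev W : at20 flip_ev W = at20 (ldev d) W \o (at11 r W |> L).
Proof. by rewrite /flip_ev; lift_simpl. Qed.

Variables (r' : hom (ldob d) X) (rK : inverse_of r r').

Definition flip_coev : hom \1 (L \ox X) := (idm L \xm r') \o ldcoev d.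

Lemma at02_flip_coev W :
  at02 flip_coev W = at11 r' (W \ox L) \o at02 (ldcoev d) W.
Proof. by rewrite /flip_coev; lift_simpl. Qed.

Lemma at11_rK W : at11 r' W \o at11 r W = idm _.
Proof. by rewrite -at11_comp (proj1 rK) at11_id. Qed.

Lemma at11_rK' W : at11 r W \o at11 r' W = idm _.
Proof. by rewrite -at11_comp (proj2 rK) at11_id. Qed.

Lemma flip_triangle :
  lun X \o (flip_ev |> X) \o associ X L X \o (idm X \xm flip_coev) \o runi X
  = idm X.
Proof.
by_lift.
rewrite at20_flip_ev at02_flip_coev tens_compl -!compA.
rewrite 2!(comp_eq2 _ (at11_nat _ r')).
rewrite at02_nat.
by rewrite (comp_eq1 _ (left_zigzag' d W)) comp1m at11_rK.
Qed.

Lemma flip_triangle' :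
  run L \o (idm L \xm flip_ev) \o assoc L X L \o (flip_coev |> L) \o luni L
  = idm L.
Proof.
by_lift.
rewrite at20_flip_ev at02_flip_coev tens_compl -!compA.
rewrite (comp_eq1 _ (whisker1 _ (at11_rK' (W \ox L)))) tensm_id comp1m.
exact: left_zigzag.
Qed.

(** L is a right dual of each of its left duals, and this is transported along
    the isomorphism r. *)
Definition flip_dual : right_dual X := RightDual flip_triangle flip_triangle'.

End DualOfDual.

(** * Images of pairings under a strong monoidal functor *)

Section Image.
Variables (D C : strict_monoidal) (U : strong_monoidal_functor D C).

Definition image_ev A B (p : hom (A \ox B) \1) : hom (U A \ox U B) \1 :=
  fun0i U \o fmap U p \o fun2 U A B.
Definition image_coev A B (q : hom \1 (A \ox B)) : hom \1 (U A \ox U B) :=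
  fun2i U A B \o fmap U q \o fun0 U.

Lemma at20_image_ev A B (p : hom (A \ox B) \1) W :
  at20 (image_ev p) W
  = at10 (fun0i U) W \o at11 (fmap U p) W \o at21 (fun2 U A B) W.
Proof. by rewrite /image_ev; lift_simpl; rewrite compA. Qed.

Lemma at02_image_coev A B (q : hom \1 (A \ox B)) W :
  at02 (image_coev q) W
  = at12 (fun2i U A B) W \o at11 (fmap U q) W \o at01 (fun0 U) W.
Proof. by rewrite /image_coev; lift_simpl; rewrite compA. Qed.

Lemma at_fun0iK W : at10 (fun0i U) W \o at01 (fun0 U) W = idm W.
Proof. by have [E _] := fun0K U; lift_in E (munit : C) (munit : C) W. Qed.
Lemma at_fun0K W : at01 (fun0 U) W \o at10 (fun0i U) W = idm _.
Proof. by have [_ E] := fun0K U; lift_in E (U \1) (U \1) W. Qed.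
Lemma at_fun2iK A B W : at12 (fun2i U A B) W \o at21 (fun2 U A B) W = idm _.
Proof. by have [E _] := fun2K U A B; lift_in E (U A \ox U B) (U A \ox U B) W. Qed.
Lemma at_fun2K A B W : at21 (fun2 U A B) W \o at12 (fun2i U A B) W = idm _.
Proof.
by have [_ E] := fun2K U A B; lift_in E (U (A \ox B)) (U (A \ox B)) W.
Qed.

Lemma at_fun2_natl A A' B (f : hom A A') W :
  at21 (fun2 U A' B) W \o (at11 (fmap U f) W |> U B)
  = at11 (fmap U (f |> B)) W \o at21 (fun2 U A B) W.
Proof.
have E := fun2_natural U f (idm B); rewrite fmap_id in E.
by lift_in E (U A \ox U B) (U (A' \ox B)) W.
Qed.

Lemma at_fun2_natr A B B' (f : hom B B') W :
  at21 (fun2 U A B') W \o at11 (fmap U f) (W \ox U A)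
  = at11 (fmap U (idm A \xm f)) W \o at21 (fun2 U A B) W.
Proof.
have E := fun2_natural U (idm A) f; rewrite fmap_id in E.
by lift_in E (U A \ox U B) (U (A \ox B')) W.
Qed.

Lemma at_fun2_assoc A B E W :
  at11 (fmap U (assoc A B E)) W \o at21 (fun2 U (A \ox B) E) W
    \o (at21 (fun2 U A B) W |> U E)
  = at21 (fun2 U A (B \ox E)) W \o at21 (fun2 U B E) (W \ox U A).
Proof.
rewrite -compA.
by lift_in (fun2_assoc U A B E) (U A \ox U B \ox U E) (U (A \ox (B \ox E))) W.
Qed.

Lemma at_fun2_unitl A W :
  at11 (fmap U (lun A)) W \o at21 (fun2 U \1 A) W \o (at01 (fun0 U) W |> U A)
  = idm _.
Proof.
by rewrite -compA; lift_in (fun2_unitl U A) ((munit : C) \ox U A) (U A) W.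
Qed.

Lemma at_fun2_unitr A W :
  at11 (fmap U (run A)) W \o at21 (fun2 U A \1) W \o at01 (fun0 U) (W \ox U A)
  = idm _.
Proof.
by rewrite -compA; lift_in (fun2_unitr U A) (U A \ox (munit : C)) (U A) W.
Qed.

Lemma fmap_eqhomK A B (e : A = B) (e' : B = A) W :
  at11 (fmap U (eqhom e')) W \o at11 (fmap U (eqhom e)) W = idm _.
Proof. by rewrite -at11_comp -fmap_comp eqhomK fmap_id at11_id. Qed.

(** The image under U of a triangle identity of A; it makes the image pairing
    nondegenerate on the side of U A. *)
Lemma image_zigzag A (d : right_dual A) W :
  (at20 (image_ev (rdev d)) W |> U A)
    \o at02 (image_coev (rdcoev d)) (W \ox U A) = idm _.
Proof.
have fmap_runi : at11 (fmap U (runi A)) W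
    = at21 (fun2 U A \1) W \o at01 (fun0 U) (W \ox U A).
  have := congr1 (fun k => at11 (fmap U (runi A)) W \o k) (at_fun2_unitr A W).
  by rewrite -!compA (comp_eq1 _ (fmap_eqhomK _ _ W)) comp1m compm1.
have := congr1 (fun k => at11 (fmap U k) W) (rd_triangle d).
rewrite fmap_id at11_id !fmap_comp !at11_comp -!compA fmap_runi.
(* Inserting fun2 and its inverse after the image of the coevaluation lets the
   associativity of fun2 regroup the three factors. *)
rewrite (comp_eq2 _ (esym (at_fun2_natr _ _ W))).
rewrite -[at11 (fmap U (rdcoev d)) _ \o _]comp1m.
rewrite -(at_fun2K (rdob d) A (W \ox U A)) -!compA.
rewrite (comp_eq2 _ (esym (at_fun2_assoc _ _ _ W))) -!compA.
rewrite (comp_eq1 _ (fmap_eqhomK _ _ W)) comp1m.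
rewrite (comp_eq2 _ (esym (at_fun2_natl _ _ W))).
rewrite (comp_eq1 _ (esym (tens_compl _ _ _))).
move=> E.
rewrite -[LHS]comp1m -(at_fun2_unitl A W) at20_image_ev at02_image_coev.
rewrite -!compA (comp_eq1 _ (esym (tens_compl _ _ _))).
by rewrite (comp_eq1 _ (at_fun0K W)) comp1m E -at_fun2_unitl -compA.
Qed.

End Image.

Lemma rebracket (C : strict_monoidal) (X Y Z T : C) :
  X \ox ((Y \ox Z) \ox T) = (X \ox Y) \ox (Z \ox T).
Proof. by rewrite !tensA. Qed.

Lemma rebracket' (C : strict_monoidal) (X Y Z T : C) :
  (X \ox Y) \ox (Z \ox T) = X \ox ((Y \ox Z) \ox T).
Proof. by rewrite !tensA. Qed.

(** * Half-braidings and their invertibility *)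

Section LaxHalfBraiding.
Variables (D C : strict_monoidal) (U : strong_monoidal_functor D C).

(** The axioms of a half-braiding other than invertibility, in terms of
    families. *)
Record lax_half_braiding (X : C)
    (s : forall A : D, hom (X \ox U A) (U A \ox X)) : Prop := LaxHalfBraiding {
  lax_nat : forall (A B : D) (f : hom A B) W,
    at22 (s B) W \o at11 (fmap U f) (W \ox X)
    = (at11 (fmap U f) W |> X) \o at22 (s A) W;
  lax_tens : forall (A B : D) W,
    at22 (s (A \ox B)) W \o at21 (fun2 U A B) (W \ox X)
    = (at21 (fun2 U A B) W |> X)
        \o (at22 (s B) (W \ox U A) \o (at22 (s A) W |> U B));
  lax_unit : forall W,
    at22 (s \1) W \o at01 (fun0 U) (W \ox X) = at01 (fun0 U) W |> X
}.

Lemma half_braiding_lax (X : C) (s : forall A : D, hom (X \ox U A) (U A \ox X)) :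
  half_braiding s -> lax_half_braiding s.
Proof.
case=> nat iso tens unit; split=> [A B f W|A B W|W].
- by lift_in (nat A B f) (X \ox U A) (U B \ox X) W.
- by lift_in (tens A B) (X \ox (U A \ox U B)) (U (A \ox B) \ox X) W.
- by lift_in unit X (U \1 \ox X) W.
Qed.

Lemma lax_half_braiding_iso (X : C)
    (s : forall A : D, hom (X \ox U A) (U A \ox X)) :
  lax_half_braiding s -> (forall A, is_iso (s A)) -> half_braiding s.
Proof.
case=> nat tens unit iso; split=> // [A B f|A B|].
- by_lift; exact: nat.
- by_lift; exact: tens.
- by_lift; exact: unit.
Qed.

Lemma at22_inverse X Y Z T (s : hom (X \ox Y) (Z \ox T)) (s' : hom (Z \ox T) (X \ox Y)) :
  inverse_of s s' -> forall W : C, inverse_of (at22 s W) (at22 s' W).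
Proof.
move=> [E E'] W; split.
- by lift_in E (X \ox Y) (X \ox Y) W.
- by lift_in E' (Z \ox T) (Z \ox T) W.
Qed.

Section Invertible.
Variables (X : C) (s : forall A : D, hom (X \ox U A) (U A \ox X)).
Hypothesis sP : lax_half_braiding s.

Lemma lax_unit_inv W :
  (at10 (fun0i U) W |> X) \o at22 (s \1) W = at10 (fun0i U) (W \ox X).
Proof.
rewrite -[LHS]compm1 -(at_fun0K U (W \ox X)) -!compA.
rewrite (comp_eq1 _ (lax_unit sP W)) compA.
by rewrite (whisker1 _ (at_fun0iK U W)) tensm_id comp1m.
Qed.

Lemma lax_tens_inv A B W :
  (at12 (fun2i U A B) W |> X) \o at22 (s (A \ox B)) W
  = at22 (s B) (W \ox U A)
      \o ((at22 (s A) W |> U B) \o at12 (fun2i U A B) (W \ox X)).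
Proof.
rewrite -[LHS]compm1 -(at_fun2K U A B (W \ox X)) -!compA.
rewrite (comp_eq1 _ (lax_tens sP A B W)) -!compA.
by rewrite (comp_eq1 _ (whisker1 _ (at_fun2iK U A B W))) tensm_id comp1m.
Qed.

(** Moving X past A and then past B agrees with moving it past the tensor product
    of A and B; by naturality the pairing p can then be applied first, and
    nothing is left to move past. *)
Lemma lax_pairing A B (p : hom (A \ox B) \1) W :
  (at20 (image_ev U p) W |> X)
    \o (at22 (s B) (W \ox U A) \o (at22 (s A) W |> U B))
  = at20 (image_ev U p) (W \ox X).
Proof.
rewrite !at20_image_ev !tens_compl -!compA.
rewrite -(lax_tens sP).
rewrite (comp_eq2 _ (esym (lax_nat sP p W))).
by rewrite (comp_eq1 _ (lax_unit_inv W)).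
Qed.

Lemma lax_copairing A B (q : hom \1 (A \ox B)) W :
  at22 (s B) (W \ox U A)
    \o ((at22 (s A) W |> U B) \o at02 (image_coev U q) (W \ox X))
  = at02 (image_coev U q) W |> X.
Proof.
rewrite !at02_image_coev !tens_compl -!compA.
rewrite (comp_eq31 _ (esym (lax_tens_inv A B W))) -compA.
rewrite (comp_eq2 _ (lax_nat sP q W)).
by rewrite lax_unit.
Qed.

(** A right dual of A, followed by a new copy of A, is created behind X; once X
    has moved past this right dual, it cancels the copy of A in front of it. *)
Definition lax_inverse A (d : right_dual A) : hom (U A \ox X) (X \ox U A) :=
  lun _ \o (image_ev U (rdev d) \xm idm (X \ox U A))
    \o eqhom (rebracket (U A) (U (rdob d)) X (U A))
    \o (idm (U A) \xm (s (rdob d) \xm idm (U A)))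
    \o eqhom (rebracket' (U A) X (U (rdob d)) (U A))
    \o (idm (U A \ox X) \xm image_coev U (rdcoev d))
    \o runi _.

Lemma at22_lax_inverse A (d : right_dual A) W :
  at22 (lax_inverse d) W
  = (at20 (image_ev U (rdev d)) W |> X |> U A)
      \o (at22 (s (rdob d)) (W \ox U A) |> U A)
      \o at02 (image_coev U (rdcoev d)) (W \ox U A \ox X).
Proof. by rewrite /lax_inverse; lift_simpl. Qed.

(** By the (co)pairing lemmas, the two crossings of either composite slide off
    the (co)evaluation, which leaves a zigzag. *)
Lemma lax_inverseP A (d : right_dual A) : inverse_of (s A) (lax_inverse d).
Proof.
split; by_lift; rewrite at22_lax_inverse -!compA.
- rewrite -at02_nat 2!(comp_eq1 _ (esym (tens_compl _ _ _))) -!compA.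
  by rewrite lax_pairing image_zigzag.
- rewrite compA -(at22_nat (at20 _ W)) -!compA.
  by rewrite lax_copairing -tens_compl image_zigzag tensm_id.
Qed.

End Invertible.
End LaxHalfBraiding.

(** * Left duals in the dual of a functor *)

Section Rotation.
Variables (C : strict_monoidal) (X : C) (d : left_dual X).
Notation L := (ldob d).

(** The partial mate of g: both copies of X are turned into L. *)
Definition rotate Y (g : hom (Y \ox X) (X \ox Y)) : hom (L \ox Y) (Y \ox L) :=
  lun _ \o (ldev d \xm idm (Y \ox L))
    \o eqhom (rebracket L X Y L)
    \o (idm L \xm (g \xm idm L))
    \o eqhom (rebracket' L Y X L)
    \o (idm (L \ox Y) \xm ldcoev d)
    \o runi _.

Lemma at22_rotate Y (g : hom (Y \ox X) (X \ox Y)) W :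
  at22 (rotate g) W
  = (at20 (ldev d) W |> Y |> L)
      \o ((at22 g (W \ox L) |> L) \o at02 (ldcoev d) (W \ox L \ox Y)).
Proof. by rewrite /rotate; lift_simpl. Qed.

(** The defining property of the partial mate with respect to the evaluation;
    rotate_coev is its counterpart for the coevaluation. *)
Lemma rotate_ev Y (g : hom (Y \ox X) (X \ox Y)) W :
  at20 (ldev d) (W \ox Y) \o (at22 (rotate g) W |> X)
  = (at20 (ldev d) W |> Y) \o at22 g (W \ox L).
Proof.
rewrite at22_rotate !tens_compl.
rewrite (comp_eq2 _ (esym (at20_nat _ _))) (comp_eq2 _ (esym (at20_nat _ _))).
by rewrite left_zigzag compm1.
Qed.

Lemma rotate_coev Y (g : hom (Y \ox X) (X \ox Y)) W :
  at22 (rotate g) (W \ox X) \o (at02 (ldcoev d) W |> Y)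
  = (at22 g W |> L) \o at02 (ldcoev d) (W \ox Y).
Proof.
rewrite at22_rotate -!compA -at02_nat.
rewrite (comp_eq2 _ (whisker2 _ (esym (at22_nat _ g)))).
by rewrite (comp_eq1 _ (whisker1 _ (whisker1 _ (left_zigzag d W)))) !tensm_id comp1m.
Qed.

Lemma rotate_tens Y Z (g : hom (Y \ox X) (X \ox Y)) (k : hom (Z \ox X) (X \ox Z))
    W :
  at22 (rotate k) (W \ox Y) \o (at22 (rotate g) W |> Z)
  = (at20 (ldev d) W |> Y |> Z |> L)
      \o ((((at22 g (W \ox L) |> Z) \o at22 k (W \ox L \ox Y)) |> L)
            \o at02 (ldcoev d) (W \ox L \ox Y \ox Z)).
Proof.
rewrite (at22_rotate g) !tens_compl.
rewrite (comp_eq2 _ (esym (at22_nat _ _))) (comp_eq2 _ (esym (at22_nat _ _))).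
by rewrite rotate_coev -!compA.
Qed.

End Rotation.

Lemma dmap_eqhom_ob (D C : strict_monoidal) (U : strong_monoidal_functor D C)
    (S T : dual_category U) (e : S = T) :
  dmap (eqhom e) = eqhom (f_equal (@dob D C U) e).
Proof. exact: dmap_eqhom. Qed.

Section DualHalfBraiding.
Variables (D C : strict_monoidal) (U : strong_monoidal_functor D C).
Variables (R : rigid_structure D) (S : dual_ob U).
Notation X := (dob S).

(** The inverse of the half-braiding, given by a formula rather than chosen. *)
Definition unbraid A : hom (U A \ox X) (X \ox U A) :=
  lax_inverse (dhb S) (rdual_of R A).

Lemma unbraidP A : inverse_of (dhb S A) (unbraid A).
Proof. by apply: lax_inverseP; apply: half_braiding_lax (dhbP S). Qed.

Lemma unbraidK A W : at22 (unbraid A) W \o at22 (dhb S A) W = idm _.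
Proof. by case: (at22_inverse (unbraidP A) W). Qed.

Lemma unbraidK' A W : at22 (dhb S A) W \o at22 (unbraid A) W = idm _.
Proof. by case: (at22_inverse (unbraidP A) W). Qed.

Lemma unbraid_nat A B (f : hom A B) W :
  at22 (unbraid B) W \o (at11 (fmap U f) W |> X)
  = at11 (fmap U f) (W \ox X) \o at22 (unbraid A) W.
Proof.
rewrite -[LHS]compm1 -(unbraidK' A W) -!compA.
rewrite (comp_eq2 _ (esym (lax_nat (half_braiding_lax (dhbP S)) f W))).
by rewrite (comp_eq1 _ (unbraidK _ _)) comp1m.
Qed.

Lemma unbraid_tens A B W :
  at22 (unbraid (A \ox B)) W \o (at21 (fun2 U A B) W |> X)
  = at21 (fun2 U A B) (W \ox X)
      \o ((at22 (unbraid A) W |> U B) \o at22 (unbraid B) (W \ox U A)).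
Proof.
rewrite -[LHS]compm1 -(unbraidK' B (W \ox U A)).
rewrite -[at22 (unbraid B) _ in LHS]comp1m -tensm_id -(unbraidK' A W).
rewrite tens_compl -!compA.
rewrite (comp_eq31 _ (esym (lax_tens (half_braiding_lax (dhbP S)) A B W))).
by rewrite -!compA (comp_eq1 _ (unbraidK _ _)) comp1m.
Qed.

Lemma unbraid_unit W :
  at22 (unbraid \1) W \o (at01 (fun0 U) W |> X) = at01 (fun0 U) (W \ox X).
Proof.
rewrite -(lax_unit (half_braiding_lax (dhbP S))).
by rewrite (comp_eq1 _ (unbraidK _ _)) comp1m.
Qed.

Variable d : left_dual X.
Notation L := (ldob d).

Definition ldual_hb A : hom (L \ox U A) (U A \ox L) := rotate d (unbraid A).

(** Naturality and the tensor and unit axioms pass from the inverse of the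
    half-braiding of S to its rotation; the tensor axiom needs in addition that
    stacked rotations are the rotation of the stack (rotate_tens). *)
Lemma ldual_hb_lax : lax_half_braiding ldual_hb.
Proof.
split=> [A B f W|A B W|W]; rewrite /ldual_hb.
- rewrite !at22_rotate -!compA -at02_nat.
  rewrite (comp_eq2 _ (whisker2 _ (unbraid_nat _ _))).
  by rewrite (comp_eq2 _ (whisker2 _ (esym (at11_nat _ _)))).
- rewrite rotate_tens at22_rotate -!compA -at02_nat.
  rewrite (comp_eq2 _ (whisker2 _ (unbraid_tens _ _ _))).
  by rewrite (comp_eq2 _ (whisker2 _ (esym (at21_nat _ _)))).
- rewrite at22_rotate -!compA -at02_nat.
  rewrite (comp_eq1 _ (whisker1 _ (unbraid_unit _))).
  rewrite (comp_eq2 _ (whisker2 _ (at01_nat _ _))).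
  by rewrite left_zigzag' compm1.
Qed.

Lemma ldual_hbP : half_braiding ldual_hb.
Proof.
apply: lax_half_braiding_iso ldual_hb_lax _ => A.
exists (lax_inverse ldual_hb (rdual_of R A)).
by apply: lax_inverseP; apply: ldual_hb_lax.
Qed.

Definition ldual_ob : dual_ob U := DualOb ldual_hbP.

Lemma dual_ev_subproof A :
  unit_hb U A \o (ldev d \xm idm (U A))
  = (idm (U A) \xm ldev d) \o tens_hb ldual_ob S A.
Proof.
rewrite /unit_hb /tens_hb; by_lift.
by rewrite (comp_eq2 _ (rotate_ev _ _ _)) unbraidK compm1.
Qed.

Lemma dual_coev_subproof A :
  tens_hb S ldual_ob A \o (ldcoev d \xm idm (U A))
  = (idm (U A) \xm ldcoev d) \o unit_hb U A.
Proof.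
rewrite /unit_hb /tens_hb; by_lift.
rewrite rotate_coev.
by rewrite (comp_eq1 _ (whisker1 _ (unbraidK' _ _))) tensm_id comp1m.
Qed.

Definition dual_ev : dual_hom (dual_tens ldual_ob S) (dual_unit U) :=
  @DualHom _ _ _ (dual_tens ldual_ob S) (dual_unit U) (ldev d)
    dual_ev_subproof.
Definition dual_coev : dual_hom (dual_unit U) (dual_tens S ldual_ob) :=
  @DualHom _ _ _ (dual_unit U) (dual_tens S ldual_ob) (ldcoev d)
    dual_coev_subproof.

Definition dual_left_dual : @left_dual (dual_monoidal U) S.
Proof.
refine (@LeftDual (dual_monoidal U) S ldual_ob dual_ev dual_coev _ _);
  apply: dual_hom_eq.
- abstract (rewrite -[RHS](ld_triangle d) /= !dmap_eqhom_ob; by eqhom_congr).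
- abstract (rewrite -[RHS](ld_triangle' d) /= !dmap_eqhom_ob; by eqhom_congr).
Defined.

End DualHalfBraiding.

(** * Dual morphisms, characterized by the evaluation *)

Section DualPairings.
Variable C : strict_monoidal.
Implicit Types X Y Z : C.

Lemma at20_inj X Y (f g : hom (X \ox Y) \1) :
  (forall W, at20 f W = at20 g W) -> f = g.
Proof. exact: (@lift_inj C (node (leaf X) (leaf Y)) one). Qed.

(** With left_dual_inj, this characterizes all the morphisms that are built as
    mates (ldualm, ldual2, ldual2i and zeta) by a universal property. *)
Lemma mate_ev X (d : left_dual X) L (e : hom (L \ox X) \1) :
  ldev d \o (mate e (ldcoev d) |> X) = e.
Proof.
apply: at20_inj => W; lift_simpl.
rewrite at11_mate tens_compl (comp_eq2 _ (esym (at20_nat _ _))).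
by rewrite left_zigzag compm1.
Qed.

(** The evaluation is a nondegenerate pairing. *)
Lemma left_pairing_inj X (d : left_dual X) V W (f g : hom V (W \ox ldob d)) :
  at20 (ldev d) W \o (f |> X) = at20 (ldev d) W \o (g |> X) -> f = g.
Proof.
have E k : k = ((at20 (ldev d) W \o (k |> X)) |> ldob d) \o at02 (ldcoev d) V.
  rewrite tens_compl -compA at02_nat.
  by rewrite (comp_eq1 _ (left_zigzag' d W)) comp1m.
by move=> fg; rewrite (E f) fg -E.
Qed.

Lemma left_dual_inj X (d : left_dual X) Z (f g : hom Z (ldob d)) :
  ldev d \o (f |> X) = ldev d \o (g |> X) -> f = g.
Proof.
move=> E; apply: at11_inj => W; apply: left_pairing_inj.
by lift_in E (Z \ox X) (munit : C) W.
Qed.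

Variable R : rigid_structure C.

Lemma ldualm_ev X Y (f : hom X Y) :
  ev R X \o (ldualm R f |> X) = ev R Y \o (idm (ldual R Y) \xm f).
Proof.
have -> : ldualm R f
    = mate (ev R Y \o (idm _ \xm f)) (coev R X).
  by rewrite /ldualm /mate; by_lift; rewrite tens_compl -compA.
exact: (mate_ev (ldual_of R X)).
Qed.

Lemma ev_zigzag X W :
  at20 (ev R X) (W \ox X) \o (at02 (coev R X) W |> X) = idm (W \ox X).
Proof. exact: left_zigzag. Qed.

Lemma ev_zigzag' X W :
  (at20 (ev R X) W |> ldual R X) \o at02 (coev R X) (W \ox ldual R X)
  = idm (W \ox ldual R X).
Proof. exact: left_zigzag'. Qed.

Lemma tens_triangle X Y :
  run (X \ox Y) \o (idm (X \ox Y) \xm ev_tens R X Y)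
    \o assoc (X \ox Y) (ldual R Y \ox ldual R X) (X \ox Y)
    \o (coev_tens R X Y \xm idm (X \ox Y)) \o luni (X \ox Y) = idm (X \ox Y).
Proof.
rewrite /ev_tens /coev_tens; by_lift; rewrite !tens_compl -?compA.
rewrite (comp_eq2 _ (whisker2 _ (esym (at20_nat _ _)))).
rewrite (whisker1 _ (ev_zigzag _ _)) tensm_id compm1.
exact: ev_zigzag.
Qed.

Lemma tens_triangle' X Y :
  lun (ldual R Y \ox ldual R X)
    \o (ev_tens R X Y \xm idm (ldual R Y \ox ldual R X))
    \o associ (ldual R Y \ox ldual R X) (X \ox Y) (ldual R Y \ox ldual R X)
    \o (idm (ldual R Y \ox ldual R X) \xm coev_tens R X Y)
    \o runi (ldual R Y \ox ldual R X) = idm (ldual R Y \ox ldual R X).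
Proof.
rewrite /ev_tens /coev_tens; by_lift; rewrite !tens_compl -?compA.
rewrite (comp_eq2 _ (whisker2 _ (at02_nat _ _))).
by rewrite (comp_eq1 _ (whisker1 _ (ev_zigzag' _ _))) tensm_id comp1m ev_zigzag'.
Qed.

Definition tens_left_dual X Y : left_dual (X \ox Y) :=
  LeftDual (tens_triangle X Y) (tens_triangle' X Y).

Lemma ldual2_ev X Y : ev R (X \ox Y) \o (ldual2 R X Y |> (X \ox Y)) = ev_tens R X Y.
Proof. exact: (mate_ev (ldual_of R (X \ox Y))). Qed.

Lemma ldual2i_ev X Y :
  ev_tens R X Y \o (ldual2i R X Y |> (X \ox Y)) = ev R (X \ox Y).
Proof. exact: (mate_ev (tens_left_dual X Y)). Qed.

Lemma ldual2K X Y : ldual2i R X Y \o ldual2 R X Y = idm _.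
Proof.
apply: (left_dual_inj (d := tens_left_dual X Y)) => /=.
by rewrite tens_compl compA ldual2i_ev ldual2_ev tensm_id compm1.
Qed.

(** The hypothesis says that t is the dual of s, when the duals of the tensor
    products are identified with tensor products of duals. *)
Lemma ldualm_ldual2i X X' Y Y' (s : hom (X \ox Y) (X' \ox Y'))
    (t : hom (ldual R Y' \ox ldual R X') (ldual R Y \ox ldual R X)) :
  ev_tens R X Y \o (t |> (X \ox Y)) = ev_tens R X' Y' \o (idm _ \xm s) ->
  t \o ldual2i R X' Y' = ldual2i R X Y \o ldualm R s.
Proof.
move=> E; apply: (left_dual_inj (d := tens_left_dual X Y)) => /=.
rewrite (tens_compl _ t) (tens_compl _ (ldual2i R X Y)) !compA E ldual2i_ev.
rewrite [RHS](ldualm_ev s) -(ldual2i_ev X' Y') -!compA.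
by rewrite tensm_xchg.
Qed.

End DualPairings.

(** * The pairing induced by a pivotal structure *)

Section PivotalPairing.
Variables (C : strict_monoidal) (P : pivotal_structure C).
Implicit Types X Y Z : C.

(** It exhibits the left dual of X as a right dual of X. *)
Definition pivot_ev X : hom (X \ox ldual P X) \1 :=
  flip_ev (d := ldual_of P (ldual P X)) (pivot P X).

Lemma at20_pivot_ev X W :
  at20 (pivot_ev X) W
  = at20 (ev P (ldual P X)) W \o (at11 (pivot P X) W |> ldual P X).
Proof. exact: at20_flip_ev. Qed.

(** This is the naturality of the pivot, read through the evaluation. *)
Lemma pivot_ev_dinatural X Y (f : hom X Y) :
  pivot_ev Y \o (f |> ldual P Y) = pivot_ev X \o (idm X \xm ldualm P f).
Proof.
rewrite /pivot_ev /flip_ev -!compA -tens_compl pivot_natural tens_compl compA.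
rewrite [_ \o (ldualm P (ldualm P f) |> _)](ldualm_ev P (ldualm P f)).
by rewrite -!compA tensm_xchg.
Qed.

Definition pivot_ev_tens X Y :
    hom ((X \ox Y) \ox (ldual P Y \ox ldual P X)) \1 :=
  ev_tens P (ldual P Y) (ldual P X) \o ((pivot P X \xm pivot P Y) \xm idm _).

(** This is the monoidality of the pivot: the double dual functor enters it by
    ldualm of ldual2i, which the evaluation turns into ldual2i on the other
    factor. *)
Lemma pivot_ev_ldual2i X Y :
  pivot_ev (X \ox Y) = pivot_ev_tens X Y \o (idm _ \xm ldual2i P X Y).
Proof.
rewrite /pivot_ev /pivot_ev_tens /flip_ev pivot_tens /lddual2 2!tens_compl 2!compA.
rewrite [_ \o (ldualm P (ldual2i P X Y) |> _)](ldualm_ev P (ldual2i P X Y)).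
rewrite -ldual2_ev -!compA; congr (_ \o _).
by rewrite [LHS]compA -tensm_xchg -compA -tensm_xchg.
Qed.

Lemma pivot_ev_tens_dinatural X Y (s : hom (X \ox Y) (Y \ox X))
    (t : hom (ldual P X \ox ldual P Y) (ldual P Y \ox ldual P X)) :
  ev_tens P X Y \o (t |> (X \ox Y)) = ev_tens P Y X \o (idm _ \xm s) ->
  pivot_ev_tens Y X \o (s |> (ldual P X \ox ldual P Y))
  = pivot_ev_tens X Y \o (idm _ \xm t).
Proof.
move=> E; have := pivot_ev_dinatural s.
rewrite !pivot_ev_ldual2i -!compA -!tensm_xchg -tens_compr.
rewrite -(ldualm_ldual2i E) tens_compr.
move/(congr1 (fun k => k \o (idm _ \xm ldual2 P Y X))).
by rewrite -!compA -!tens_compr -compA ldual2K compm1 tensm_id compm1.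
Qed.

(** If t is the full rotation of s with respect to the evaluations, then so is
    it with respect to the pairings of the pivotal structure, which sit on the
    other side. *)
Lemma pivot_pairing_braid X Y (s : hom (X \ox Y) (Y \ox X))
    (t : hom (ldual P X \ox ldual P Y) (ldual P Y \ox ldual P X)) :
  (forall W,
    at20 (ev P Y) W \o ((at20 (ev P X) (W \ox ldual P Y) |> Y)
      \o (at22 t W |> X |> Y))
    = at20 (ev P X) W \o ((at20 (ev P Y) (W \ox ldual P X) |> X)
      \o at22 s (W \ox ldual P X \ox ldual P Y))) ->
  forall W,
    at20 (pivot_ev Y) W \o ((at20 (pivot_ev X) (W \ox Y) |> ldual P Y)
      \o (at22 s W |> ldual P X |> ldual P Y))
    = at20 (pivot_ev X) W \o ((at20 (pivot_ev Y) (W \ox X) |> ldual P X)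
      \o at22 t (W \ox X \ox Y)).
Proof.
move=> E W.
have Et : ev_tens P X Y \o (t |> (X \ox Y)) = ev_tens P Y X \o (idm _ \xm s).
  by rewrite /ev_tens; by_lift; exact: E.
have Ev := pivot_ev_tens_dinatural Et.
have split2 (V V' Z Z' : C) (f : hom V V') (g : hom Z Z') :
    f \xm g = (f |> Z') \o (idm V \xm g) by rewrite -tensm_comp comp1m compm1.
rewrite /pivot_ev_tens /ev_tens (split2 _ _ _ _ (pivot P X) (pivot P Y)) in Ev.
rewrite (split2 _ _ _ _ (pivot P Y) (pivot P X)) in Ev.
lift_in Ev ((X \ox Y) \ox (ldual P X \ox ldual P Y)) (munit : C) W.
rewrite !at20_pivot_ev !tens_compl -!compA => EW.
by rewrite 2!(comp_eq2 _ (whisker2 _ (at20_nat _ _))).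
Qed.

End PivotalPairing.

Lemma at20_image_evl (D C : strict_monoidal) (U : strong_monoidal_functor D C)
    A A' B (p : hom (A' \ox B) \1) (f : hom A A') W :
  at20 (image_ev U (p \o (f |> B))) W
  = at20 (image_ev U p) W \o (at11 (fmap U f) W |> U B).
Proof.
rewrite !at20_image_ev fmap_comp at11_comp -!compA.
by rewrite at_fun2_natl.
Qed.

(** * The pivotal structure of the dual of a pivotal functor *)

Section PivotalFunctor.
Variables (D C : pivotal_category) (U : strong_monoidal_functor D C).
Hypothesis U_pivotal : preserves_pivotal U (pstr D) (pstr C).
Notation PD := (pstr D).
Notation PC := (pstr C).
Notation zetaU A := (zeta U PD PC A).

Lemma zeta_ev A : ev PC (U A) \o (zetaU A |> U A) = image_ev U (ev PD A).
Proof. exact: (mate_ev (ldual_of PC (U A))). Qed.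

Lemma at_zeta_ev A W :
  at20 (ev PC (U A)) W \o (at11 (zetaU A) W |> U A)
  = at20 (image_ev U (ev PD A)) W.
Proof. by lift_in (zeta_ev A) (U (ldual PD A) \ox U A) (munit : C) W. Qed.

Lemma at_ldualm_ev X Y (f : hom X Y) W :
  at20 (ev PC X) W \o (at11 (ldualm PC f) W |> X)
  = at20 (ev PC Y) W \o at11 f (W \ox ldual PC Y).
Proof. by lift_in (ldualm_ev PC f) (ldual PC Y \ox X) (munit : C) W. Qed.

(** Preservation of the pivotal structure, read through the evaluation: the
    inverse of zeta at A cancels against zeta at A, and zeta at the left dual of
    A turns an evaluation in C into the image of an evaluation in D. *)
Lemma image_pivot_ev A W :
  at20 (pivot_ev PC (U A)) W \o at11 (zetaU A) (W \ox U A)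
  = at20 (image_ev U (pivot_ev PD A)) W.
Proof.
have [z [[zK _] E]] := U_pivotal A.
have zKW V : at11 z V \o at11 (zetaU A) V = idm _ by rewrite -at11_comp zK at11_id.
rewrite at20_pivot_ev E 2!at11_comp 2!tens_compl -!compA.
rewrite (comp_eq2 _ (at_ldualm_ev z W)).
rewrite (at11_nat _ (zetaU A)) (comp_eq2 _ (at11_nat _ (zetaU A))).
rewrite (comp_eq1 _ (zKW _)) comp1m (comp_eq1 _ (at_zeta_ev _ W)).
by rewrite at20_image_evl.
Qed.

(** The pivot of A is invertible, so its pairing is the evaluation of a right
    dual, and the image of a zigzag recovers f. *)
Lemma image_pivot_ev_inj A V W (f g : hom V (W \ox U A)) :
  at20 (image_ev U (pivot_ev PD A)) W \o (f |> U (ldual PD A))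
  = at20 (image_ev U (pivot_ev PD A)) W \o (g |> U (ldual PD A)) -> f = g.
Proof.
have [r' rK] := pivot_iso PD A; pose d := flip_dual rK.
have E k : k = ((at20 (image_ev U (rdev d)) W \o (k |> U (rdob d))) |> U A)
    \o at02 (image_coev U (rdcoev d)) V.
  rewrite tens_compl -compA at02_nat.
  by rewrite (comp_eq1 _ (image_zigzag U d W)) comp1m.
by move=> fg; rewrite (E f) [X in X |> _]fg -E.
Qed.

Section DualObject.
Variable S : dual_ob U.
Notation X := (dob S).
Notation L := (ldual PC X).
Notation tau := (ldual_hb PD (ldual_of PC X)).

(** Full rotation of the half-braiding s_A of S gives tau at the left dual of A.
    To identify them, tau is unrotated into the inverse of s at this dual, and
    the naturality of s with respect to the evaluation of A (braid below) turns
    this inverse back into s_A. *)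
Lemma pivot_ev_tau A W :
  at20 (image_ev U (pivot_ev PD A)) W
    \o ((at20 (pivot_ev PC X) (W \ox U A) |> U (ldual PD A))
          \o (at22 (dhb S A) W |> L |> U (ldual PD A)))
  = at20 (pivot_ev PC X) W
      \o ((at20 (image_ev U (pivot_ev PD A)) (W \ox X) |> L)
            \o at22 (tau (ldual PD A)) (W \ox X \ox U A)).
Proof.
have [z [[zK Kz] _]] := U_pivotal A.
have zKW V : at11 z V \o at11 (zetaU A) V = idm _ by rewrite -at11_comp zK at11_id.
have KzW V : at11 (zetaU A) V \o at11 z V = idm _ by rewrite -at11_comp Kz at11_id.
(* tau, moved to the left dual of U A along zeta, whose inverse is z. *)
pose t : hom (L \ox ldual PC (U A)) (ldual PC (U A) \ox L) :=
  (zetaU A |> L) \o tau (ldual PD A) \o (idm L \xm z).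
have tE V : at22 t V = (at11 (zetaU A) V |> L)
    \o (at22 (tau (ldual PD A)) V \o at11 z (V \ox L)).
  by rewrite /t; lift_simpl.
have z_ev V : at20 (image_ev U (ev PD A)) V \o (at11 z V |> U A)
    = at20 (ev PC (U A)) V.
  by rewrite -at_zeta_ev -compA (whisker1 _ (KzW V)) tensm_id compm1.
have braid V : at20 (image_ev U (ev PD A)) (V \ox X) \o
      (at22 (unbraid PD S (ldual PD A)) V |> U A)
    = (at20 (image_ev U (ev PD A)) V |> X)
        \o at22 (dhb S A) (V \ox U (ldual PD A)).
  rewrite -(lax_pairing (half_braiding_lax (dhbP S))) -!compA.
  by rewrite (whisker1 _ (unbraidK' _ _ _ _)) tensm_id compm1.
have E V : at20 (ev PC (U A)) V
      \o ((at20 (ev PC X) (V \ox ldual PC (U A)) |> U A) \o (at22 t V |> X |> U A))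
    = at20 (ev PC X) V
      \o ((at20 (ev PC (U A)) (V \ox L) |> X)
            \o at22 (dhb S A) (V \ox L \ox ldual PC (U A))).
  rewrite tE !tens_compl -?compA.
  rewrite (comp_eq2 _ (whisker2 _ (esym (at20_nat _ (ev PC X))))).
  rewrite (comp_eq1 _ (at_zeta_ev A V)).
  rewrite (comp_eq2 _ (whisker2 _ (rotate_ev _ _ _))).
  rewrite (comp_eq2 _ (esym (at20_nat _ (image_ev U _)))) (comp_eq2 _ (braid _)).
  by rewrite -at22_nat (comp_eq1 _ (whisker1 _ (z_ev _))).
have := pivot_pairing_braid E W.
move/(congr1 (fun k => k \o at11 (zetaU A) (W \ox X \ox U A \ox L))).
rewrite tE -!compA zKW compm1.
rewrite (at11_nat _ (zetaU A)) (comp_eq2 _ (at11_nat _ (zetaU A))).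
rewrite (comp_eq1 _ (image_pivot_ev A W)).
by rewrite (comp_eq1 _ (whisker1 _ (image_pivot_ev A (W \ox X)))).
Qed.

(** Paired with the image of pivot_ev at A, the left-hand side contains s_A, which
    pivot_ev_tau trades for tau at the left dual of A; together with tau at A it
    cancels by naturality of tau with respect to pivot_ev at A. *)
Lemma pivot_ev_dual_hom A W :
  at20 (pivot_ev PC X) (W \ox U A)
    \o ((at22 (dhb S A) W |> L) \o at22 (tau A) (W \ox X))
  = at20 (pivot_ev PC X) W |> U A.
Proof.
apply: image_pivot_ev_inj; rewrite !tens_compl.
rewrite (comp_eq31 _ (pivot_ev_tau A W)) -!compA.
rewrite -at20_nat; congr (_ \o _).
exact: (lax_pairing (ldual_hb_lax _ _)).
Qed.

(** Pairing both sides with L turns the half-braiding of the double dual into the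
    inverse of tau, and the claim into pivot_ev_dual_hom. *)
Lemma pivot_dual_subproof A :
  dhb (@ldual_ob D C U PD (ldual_ob PD (ldual_of PC X)) (ldual_of PC L)) A
    \o (pivot PC X |> U A)
  = (idm (U A) \xm pivot PC X) \o dhb S A.
Proof.
by_lift; apply: left_pairing_inj.
rewrite !tens_compl (comp_eq2 _ (rotate_ev _ _ _)).
rewrite -/(ev PC (ldual PC X)) -at22_nat.
rewrite (comp_eq1 _ (whisker1 _ (esym (at20_pivot_ev PC X W)))).
rewrite (comp_eq1 _ (esym (at20_pivot_ev PC X (W \ox U A)))).
rewrite -(pivot_ev_dual_hom A W) -!compA.
by rewrite (unbraidK' PD (ldual_ob PD (ldual_of PC X)) A) compm1.
Qed.
End DualObject.

Definition dual_ldual (S : dual_monoidal U) : left_dual S :=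
  dual_left_dual PD (ldual_of PC (dob S)).

Definition dual_pivot (S : dual_monoidal U) :
    hom S (ldob (dual_ldual (ldob (dual_ldual S)))) :=
  DualHom (pivot_dual_subproof S).

Lemma dual_hom_iso (S T : dual_ob U) (f : dual_hom S T) :
  is_iso (dmap f) -> is_iso (C := dual_category U) f.
Proof.
move=> [g [gf fg]].
have gP A : dhb S A \o (g |> U A) = (idm (U A) \xm g) \o dhb T A.
  rewrite -[LHS]comp1m -tensm_id -[X in _ \xm X]gf tens_compr -!compA.
  by rewrite (comp_eq2 _ (esym (dmapP f A))) -tens_compl fg tensm_id compm1.
by exists (DualHom gP); split; apply: dual_hom_eq.
Qed.

Lemma dual_pivot_iso S : is_iso (dual_pivot S).
Proof. by apply: dual_hom_iso; apply: pivot_iso. Qed.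

(** Right duals are data, whereas dual_pivot_iso only asserts the existence of an
    inverse. *)
Definition dual_pivot_inv S :=
  constructive_indefinite_description _ (dual_pivot_iso S).

Definition dual_rigid : rigid_structure (dual_monoidal U) :=
  RigidStructure dual_ldual (fun S => flip_dual (proj2_sig (dual_pivot_inv S))).

Lemma dmap_comp (S T V : dual_monoidal U) (g : hom T V) (f : hom S T) :
  dmap (g \o f) = dmap g \o dmap f.
Proof. by []. Qed.

(** The forgetful functor preserves the chosen duals on the nose, hence all that
    is built from them, up to the choice of equality proofs between objects. *)
Lemma dmap_ldualm (S T : dual_monoidal U) (f : hom S T) :
  dmap (ldualm dual_rigid f) = ldualm PC (dmap f).
Proof. by rewrite /ldualm /= !dmap_eqhom_ob; eqhom_congr. Qed.

Lemma dmap_lddual2 (S T : dual_monoidal U) :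
  dmap (lddual2 dual_rigid S T) = lddual2 PC (dob S) (dob T).
Proof.
rewrite /lddual2 dmap_comp dmap_ldualm; congr (ldualm _ _ \o _).
- by rewrite /ldual2i /mate /coev_tens /= !dmap_eqhom_ob; eqhom_congr.
- by rewrite /ldual2 /mate /ev_tens /= !dmap_eqhom_ob; eqhom_congr.
Qed.

Lemma dmap_lddual0 : dmap (lddual0 dual_rigid) = lddual0 PC.
Proof.
rewrite /lddual0 dmap_comp dmap_ldualm; congr (ldualm _ _ \o _).
- by rewrite /ldual0i /mate /= !dmap_eqhom_ob; eqhom_congr.
- by rewrite /ldual0 /mate /= !dmap_eqhom_ob; eqhom_congr.
Qed.

Definition dual_pivotal : pivotal_structure (dual_monoidal U).
Proof.
refine (@PivotalStructure (dual_monoidal U) dual_rigid dual_pivot _ _ _ _).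
- abstract (move=> S T f; apply: dual_hom_eq;
    rewrite [RHS]dmap_comp 2!dmap_ldualm; exact: pivot_natural).
- exact: dual_pivot_iso.
- abstract (move=> S T; apply: dual_hom_eq;
    rewrite [RHS]dmap_comp dmap_lddual2; exact: pivot_tens).
- abstract (apply: dual_hom_eq; rewrite dmap_lddual0; exact: pivot_unit).
Defined.

Lemma dual_forget_zeta (S : dual_monoidal U) :
  zeta (dual_forget U) dual_pivotal PC S = idm (ldual PC (dob S)).
Proof.
rewrite /zeta /= comp1m compm1.
exact: (ld_triangle' (ldual_of PC (dob S))).
Qed.

Lemma ldualm_id X : ldualm PC (idm X) = idm (ldual PC X).
Proof.
by apply: (left_dual_inj (d := ldual_of PC X)); rewrite [LHS]ldualm_ev.
Qed.

Lemma dual_forget_pivotal : preserves_pivotal (dual_forget U) dual_pivotal PC.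
Proof.
move=> S; exists (idm (ldual PC (dob S))).
rewrite !dual_forget_zeta; split; first by split; rewrite comp1m.
rewrite ldualm_id !comp1m.
by [].
Qed.

End PivotalFunctor.

Theorem theorem6p2 (C D : pivotal_category)
    (U : strong_monoidal_functor D C)
    (U_pivotal : preserves_pivotal U (pstr D) (pstr C))
    (U_duality : strictly_preserves_duality U (pstr D) (pstr C)) :
  exists P : pivotal_structure (dual_monoidal U),
    preserves_pivotal (dual_forget U) P (pstr C).
Proof. by exists (dual_pivotal U_pivotal); apply: dual_forget_pivotal. Qed.
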